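(* Let $\alpha,\beta,\alpha_1,\alpha_2,x_1,x_2,p\in\mathbb{C}$ and $\lambda\in\mathbb{R}$ with $\Re(\alpha)>0$, $\Re(\beta)>0$, $\lambda\ge 0$, $|x_1|<1$, $|x_2|<1$; when $\lambda=0$ assume also $|p|<4$. Then $$\frac{1}{B(\alpha,\beta)}\int_0^1 t^{\alpha-1}(1-t)^{\beta-1}(1-x_1t)^{-\alpha_1}\bigl(1-x_2(1-t)\bigr)^{-\alpha_2}\,E_\lambda[p\,t(1-t)]\,dt$$ $$=\sum_{m,n=0}^{\infty}\frac{(\alpha)_m(\beta)_n(\alpha_1)_m(\alpha_2)_n\,x_1^m x_2^n}{(\alpha+\beta)_{m+n}\,m!\,n!}\;{}_3\hat\Psi_2\left[\begin{array}{c}(\alpha+m,1),(\beta+n,1),(1,1);\\(\alpha+\beta+m+n,2),(1,\lambda);\end{array}\;p\right].$$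
   Context: $B(x,y)=\Gamma(x)\Gamma(y)/\Gamma(x+y)$ is the beta function and $(a)_n=\Gamma(a+n)/\Gamma(a)=a(a+1)\cdots(a+n-1)$ (with $(a)_0=1$) is the Pochhammer symbol. The Mittag-Leffler function is $E_\lambda(z)=\sum_{n=0}^\infty \frac{z^n}{\Gamma(\lambda n+1)}$ for $\lambda\ge 0$; for $\lambda=0$ it is $E_0(z)=1/(1-z)$ with $|z|<1$. The normalized Wright hypergeometric function is $${}_p\hat\Psi_q\left[\begin{array}{c}(a_1,A_1),\ldots,(a_p,A_p);\\(b_1,B_1),\ldots,(b_q,B_q);\end{array}z\right]=\sum_{k=0}^\infty\frac{\prod_{j=1}^p\Gamma(a_j+A_jk)/\Gamma(a_j)}{\prod_{j=1}^q\Gamma(b_j+B_jk)/\Gamma(b_j)}\,\frac{z^k}{k!}$$ (a parameter pair $(1,0)$ contributes the factor $1$). Complex powers $(1-x_1t)^{-\alpha_1}$ and $(1-x_2(1-t))^{-\alpha_2}$ are principal values. *)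

(* Defs.v *)
From HB Require Import structures.
From mathcomp Require Import all_boot all_order all_algebra.
From mathcomp Require Import complex.
From mathcomp.analysis Require Import showcase.summability.
From mathcomp Require Import all_classical all_reals all_analysis.

Set Implicit Arguments.
Unset Strict Implicit.
Unset Printing Implicit Defensive.

Import Order.TTheory GRing.Theory Num.Theory.
Import numFieldNormedType.Exports.

Local Open Scope classical_set_scope.
Local Open Scope ring_scope.
Local Open Scope complex_scope.

(* Written in MathComp, with MathComp-Analysis for the analysis and real-closed
   for R[i].
   The topology on R[i] is that of the normed module R[i]^o. *)

Section complex_functions.
Context {R : realType}.
Implicit Types (z w : R[i]) (D : set R).

Definition cexp z : R[i] :=
  (expR (complex.Re z))%:C * (cos (complex.Im z) +i* sin (complex.Im z)).

(* Principal argument, with values in ]-pi, pi]. *)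
Definition carg z : R :=
  let a := acos (complex.Re z / ComplexField.Normc.normc z) in
  if 0 <= complex.Im z then a else - a.

Definition clog z : R[i] := ln (ComplexField.Normc.normc z) +i* carg z.

(* Principal value of z ^ w; 0 ^ w follows the convention of powR. *)
Definition cpow z w : R[i] :=
  if z == 0 then (w == 0)%:R else cexp (w * clog z).

Definition cintegrable D (f : R -> R[i]) : Prop :=
  (@lebesgue_measure R).-integrable D (fun t => (complex.Re (f t))%:E) /\
  (@lebesgue_measure R).-integrable D (fun t => (complex.Im (f t))%:E).

Definition cintegral D (f : R -> R[i]) : R[i] :=
  (\int[@lebesgue_measure R]_(t in D) complex.Re (f t)) +i*
  (\int[@lebesgue_measure R]_(t in D) complex.Im (f t)).

Definition cseries_cvg (u : nat -> R[i]) : Prop :=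
  cvgn (series (u : nat -> R[i]^o)).

Definition cseries (u : nat -> R[i]) : R[i] :=
  limn (series (u : nat -> R[i]^o)).

(* The double series are unordered sums, i.e. limits of the sums over finite
   sets of pairs ordered by inclusion; for complex terms, convergence is then
   the same as absolute convergence. *)
Definition cseries2_cvg (u : nat -> nat -> R[i]) : Prop :=
  cvg (partial_sum (fun mn : nat * nat => u mn.1 mn.2 : R[i]^o) @ totally).

Definition cseries2 (u : nat -> nat -> R[i]) : R[i] :=
  summability.sum (fun mn : nat * nat => u mn.1 mn.2 : R[i]^o).

Definition pochhammer z n : R[i] := \prod_(i < n) (z + i%:R).

(* Euler's integral for Re z > 0, continued to Re z <= 0 by
   Gamma z = Gamma (z + n) / (z)_n with n least such that Re (z + n) > 0.
   At the poles the value is 0, since (z)_n = 0 and 0^-1 = 0. *)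
Definition gamma_integral z : R[i] :=
  cintegral `]0, +oo[ (fun t => cpow t%:C (z - 1) * cexp (- t%:C)).

Definition gamma z : R[i] :=
  let n := if 0 < complex.Re z then 0%N
           else (Num.truncn (- complex.Re z)).+1 in
  gamma_integral (z + n%:R) / pochhammer z n.

Definition beta_function z w : R[i] := gamma z * gamma w / gamma (z + w).

(* For lambda = 0 the series is geometric, with sum 1 / (1 - z) for |z| < 1. *)
Definition mittag_leffler_term (lambda : R) z (n : nat) : R[i] :=
  z ^+ n / gamma (lambda * n%:R + 1)%:C.

Definition mittag_leffler (lambda : R) z : R[i] :=
  cseries (mittag_leffler_term lambda z).

Definition wright_factor (aA : R[i] * R) (k : nat) : R[i] :=
  gamma (aA.1 + (aA.2 * k%:R)%:C) / gamma aA.1.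

(* The upper parameters (a_j, A_j) are listed in aAs, the lower parameters
   (b_j, B_j) in bBs. *)
Definition wright_hat_term (aAs bBs : seq (R[i] * R)) z (k : nat) : R[i] :=
  (\prod_(aA <- aAs) wright_factor aA k) /
  (\prod_(bB <- bBs) wright_factor bB k) * (z ^+ k / k`!%:R).

Definition wright_hat (aAs bBs : seq (R[i] * R)) z : R[i] :=
  cseries (wright_hat_term aAs bBs z).

End complex_functions.

(* Main.v *)
Require Import Defs.
From HB Require Import structures.
From mathcomp Require Import all_boot all_order all_algebra.
From mathcomp Require Import complex.
From mathcomp Require Import ring lra.
From mathcomp Require Import all_classical all_reals all_analysis measurable_realfun.

Set Implicit Arguments.
Unset Strict Implicit.
Unset Printing Implicit Defensive.

Import Order.TTheory GRing.Theory Num.Theory.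
Import numFieldNormedType.Exports.

Local Open Scope classical_set_scope.
Local Open Scope ring_scope.
Local Open Scope complex_scope.

Local Notation Re := (@complex.Re _).
Local Notation Im := (@complex.Im _).
Local Notation normc := (@ComplexField.Normc.normc _).
Local Notation mu := (@lebesgue_measure _).

(** The two principal powers in the integrand are sums of binomial series,
[(1 - x1 t) ^ (- alpha1) = sum_m (alpha1)_m / m! (x1 t) ^ m] and likewise for
the other one, and the Mittag-Leffler function is a power series in
[p t (1 - t)].  Multiplying out, the integrand becomes a triple series of
multiples of [t ^ (alpha + m + k - 1) (1 - t) ^ (beta + n + k - 1)], and each
of these integrates to [B (alpha + m + k, beta + n + k)].  Writing beta as a
quotient of gammas ([beta_integral_gamma]) and shifting the arguments by
integers ([gammaDn]) produces the Pochhammer symbols: the sum over [k] is the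
Wright function ([wright_hat_termE], [beta_function_shift]) and the sum over
[(m, n)] is the announced double series.

Sums and integral may be exchanged because all three series are dominated,
uniformly in [t] in ]0, 1[, by convergent geometric series: the binomial ones
since [|x1|, |x2| < 1] ([binomial_coef_geometric]), the Mittag-Leffler one since
[t (1 - t) <= 1/4] and [Gamma (lambda k + 1)] grows faster than any geometric
sequence when [lambda > 0], while [|p| / 4 < 1] takes over when [lambda = 0]
([mittag_leffler_geometric]).  What is left is the integrable weight
[|t ^ (alpha - 1) (1 - t) ^ (beta - 1)|], so dominated convergence applies
([cintegral_cvg]), first to the sum over [k] ([beta_mittag_leffler]), then to
the square partial sums in [(m, n)]; the product majorant makes the double
series converge as an unordered sum ([cseries2_square]).

Two classical facts carry the rest.

Euler's beta identity [Gamma z Gamma w = B (z, w) Gamma (z + w)]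
([gamma_beta]) holds because the convolution of [t ^ (z - 1) exp (- t)] and
[t ^ (w - 1) exp (- t)] is [B (z, w) t ^ (z + w - 1) exp (- t)], and the integral
of a convolution is the product of the integrals ([cintegral_convolution]).
Since [B (z, 1) = 1 / z], it contains the functional equation of Gamma.
Dividing by Gamma requires that it does not vanish for [Re z > 0]
([gamma_neq0]): for a large real part the mass of [t ^ (Re z - 1) exp (- t)] is
concentrated where [t ^ (i Im z)] hardly turns, and the functional equation
brings the result down to all [Re z > 0].

The binomial theorem for principal powers ([binomial_theorem]) is proved along
the segment from 0 to [x], where the product of the series with the opposite
power has derivative 0. *)

(** * Complex numbers and complex series *)

Section complex_basics.
Context {R : realType}.
Implicit Types (z w : R[i]) (a b : R).

Lemma ReD z w : Re (z + w) = Re z + Re w. Proof. by case: z w => ? ? []. Qed.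
Lemma ImD z w : Im (z + w) = Im z + Im w. Proof. by case: z w => ? ? []. Qed.
Lemma ReN z : Re (- z) = - Re z. Proof. by case: z. Qed.
Lemma ImN z : Im (- z) = - Im z. Proof. by case: z. Qed.
Lemma ReB z w : Re (z - w) = Re z - Re w. Proof. by rewrite ReD ReN. Qed.
Lemma ImB z w : Im (z - w) = Im z - Im w. Proof. by rewrite ImD ImN. Qed.
Lemma ReM z w : Re (z * w) = Re z * Re w - Im z * Im w.
Proof. by case: z w => ? ? []. Qed.
Lemma ImM z w : Im (z * w) = Re z * Im w + Im z * Re w.
Proof. by case: z w => ? ? []. Qed.
Lemma Re_sum I (r : seq I) (P : pred I) (F : I -> R[i]) :
  Re (\sum_(i <- r | P i) F i) = \sum_(i <- r | P i) Re (F i).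
Proof. exact: (big_morph _ ReD). Qed.
Lemma Im_sum I (r : seq I) (P : pred I) (F : I -> R[i]) :
  Im (\sum_(i <- r | P i) F i) = \sum_(i <- r | P i) Im (F i).
Proof. exact: (big_morph _ ImD). Qed.

Lemma complex_ext z w : Re z = Re w -> Im z = Im w -> z = w.
Proof. by case: z w => ? ? [? ?] /= -> ->. Qed.

Lemma normc_normr z : `|z| = (normc z)%:C.
Proof. by []. Qed.

Lemma normc_ge0 z : 0 <= normc z.
Proof. by case: z => a b; exact: sqrtr_ge0. Qed.

Lemma normcD z w : normc (z + w) <= normc z + normc w.
Proof. exact: le_normcD. Qed.

Lemma normcX z n : normc (z ^+ n) = normc z ^+ n.
Proof.
elim: n => [|n IH]; first by rewrite !expr0 ComplexField.Normc.normc1.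
by rewrite !exprS ComplexField.Normc.normcM IH.
Qed.

Lemma normcR a : normc a%:C = `|a|.
Proof. by rewrite /= expr0n /= addr0 sqrtr_sqr. Qed.

Lemma natC n : (n%:R : R[i]) = (n%:R : R)%:C.
Proof. by rewrite rmorph_nat. Qed.

Lemma normc_nat n : normc (n%:R : R[i]) = n%:R.
Proof. by rewrite natC normcR normr_nat. Qed.

Lemma ReMr z a : Re (z * a%:C) = Re z * a.
Proof. by rewrite ReM /= mulr0 subr0. Qed.

Lemma ReDn z n : Re (z + n%:R) = Re z + n%:R.
Proof. by rewrite ReD natC. Qed.

Lemma normc_eq0 z : (normc z == 0) = (z == 0).
Proof.
apply/eqP/eqP => [/ComplexField.Normc.eq0_normc//|->].
exact: ComplexField.Normc.normc0.
Qed.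

Lemma normc_gt0 z : (0 < normc z) = (z != 0).
Proof. by rewrite lt0r normc_eq0 normc_ge0 andbT. Qed.

Lemma sqr_normcE z : normc z ^+ 2 = Re z ^+ 2 + Im z ^+ 2.
Proof. by case: z => a b /=; rewrite sqr_sqrtr // addr_ge0 // sqr_ge0. Qed.

Lemma Re_le_normc z : `|Re z| <= normc z.
Proof.
by case: z => a b /=; rewrite -sqrtr_sqr ler_wsqrtr // lerDl sqr_ge0.
Qed.

Lemma Im_le_normc z : `|Im z| <= normc z.
Proof.
by case: z => a b /=; rewrite -sqrtr_sqr ler_wsqrtr // lerDr sqr_ge0.
Qed.

Lemma normc_le_ReIm z : normc z <= `|Re z| + `|Im z|.
Proof.
rewrite -ler_sqr ?nnegrE ?addr_ge0 ?normc_ge0 //.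
rewrite sqr_normcE sqrrD !real_normK ?num_real //.
by rewrite lerD2r lerDl mulrn_wge0 // mulr_ge0.
Qed.

Lemma normc_sum I (r : seq I) (P : pred I) (F : I -> R[i]) :
  normc (\sum_(i <- r | P i) F i) <= \sum_(i <- r | P i) normc (F i).
Proof.
elim/big_ind2 : _ => //; first by rewrite ComplexField.Normc.normc0.
by move=> x1 x2 y1 y2 h1 h2; apply: le_trans (normcD _ _) _; exact: lerD.
Qed.

(** The norm of [R[i]^o] takes its values in [R[i]] itself, so limits are
reduced once and for all to limits of real and imaginary parts, to which the
real theory applies. *)
Lemma ccvgP (T : Type) (F : set_system T) (FF : ProperFilter F)
    (u : T -> R[i]) (l : R[i]) :
  ((u : T -> R[i]^o) @ F --> (l : R[i]^o)) <->
  ((Re \o u) @ F --> Re l) /\ ((Im \o u) @ F --> Im l).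
Proof.
split=> [/cvgrPdist_lt ul|[/cvgrPdist_lt h1 /cvgrPdist_lt h2]].
  split; apply/cvgrPdist_lt => e e0.
    have /ul : 0 < e%:C :> R[i] by rewrite ltcR.
    apply: filterS => t; rewrite normc_normr ltcR; apply: le_lt_trans.
    by rewrite /= -ReB Re_le_normc.
  have /ul : 0 < e%:C :> R[i] by rewrite ltcR.
  apply: filterS => t; rewrite normc_normr ltcR; apply: le_lt_trans.
  by rewrite /= -ImB Im_le_normc.
apply/cvgrPdist_lt => e e0.
have [e1 e2] : Im e = 0 /\ 0 < Re e by move: e0; rewrite ltcE => /andP[/eqP].
have -> : e = (Re e)%:C by apply: complex_ext.
have e3 : 0 < Re e / 2 by rewrite divr_gt0.
near=> t.
rewrite normc_normr ltcR; apply: le_lt_trans (normc_le_ReIm _) _.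
rewrite ReB ImB (splitr (Re e)) ltrD //.
  by near: t; exact: h1.
by near: t; exact: h2.
Unshelve. all: by end_near. Qed.

Lemma ccvg_unique (T : Type) (F : set_system T) (FF : ProperFilter F)
    (u : T -> R[i]) (l l' : R[i]) :
  ((u : T -> R[i]^o) @ F --> (l : R[i]^o)) ->
  ((u : T -> R[i]^o) @ F --> (l' : R[i]^o)) -> l = l'.
Proof. by move=> h1 h2; exact: (cvg_unique (@norm_hausdorff _ _) h1 h2). Qed.

Lemma ccvg_seriesP (u : nat -> R[i]) l :
  (series (u : nat -> R[i]^o) @ \oo --> (l : R[i]^o)) <->
  (series (Re \o u) @ \oo --> Re l) /\ (series (Im \o u) @ \oo --> Im l).
Proof.
have -> : series (Re \o u) = Re \o series (u : nat -> R[i]).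
  by apply/funext => n; rewrite /series /= Re_sum.
have -> : series (Im \o u) = Im \o series (u : nat -> R[i]).
  by apply/funext => n; rewrite /series /= Im_sum.
exact: ccvgP.
Qed.

Lemma cseriesP (u : nat -> R[i]) l :
  (series (u : nat -> R[i]^o) @ \oo --> (l : R[i]^o)) ->
  cseries_cvg u /\ cseries u = l.
Proof.
move=> h; split; first by apply/cvg_ex; exists l.
exact: (cvg_lim (@norm_hausdorff _ _) h).
Qed.

Lemma cseries_cvgP (u : nat -> R[i]) : cseries_cvg u ->
  series (u : nat -> R[i]^o) @ \oo --> (cseries u : R[i]^o).
Proof. by []. Qed.

Lemma cseries_dominated (u : nat -> R[i]) (a : nat -> R) :
  (forall n, normc (u n) <= a n) -> cvgn (series a) -> cseries_cvg u.
Proof.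
move=> ua ca.
have h (v : nat -> R) : (forall n, `|v n| <= a n) -> cvgn (series v).
  move=> va; apply: normed_cvg.
  apply: series_le_cvg ca => n //=.
  exact: le_trans (normr_ge0 (v n)) (va n).
have /cvg_ex[l1 hl1] := h (Re \o u) (fun n => le_trans (Re_le_normc _) (ua n)).
have /cvg_ex[l2 hl2] := h (Im \o u) (fun n => le_trans (Im_le_normc _) (ua n)).
by apply/cvg_ex; exists (l1 +i* l2); apply/ccvg_seriesP.
Qed.

Lemma ccvgM (T : Type) (F : set_system T) (FF : ProperFilter F)
    (u v : T -> R[i]) (l m : R[i]) :
  ((u : T -> R[i]^o) @ F --> (l : R[i]^o)) ->
  ((v : T -> R[i]^o) @ F --> (m : R[i]^o)) ->
  (((fun t => u t * v t) : T -> R[i]^o) @ F --> (l * m : R[i]^o)).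
Proof. by move=> h1 h2; exact: (cvgM h1 h2). Qed.

Lemma ccvgB (T : Type) (F : set_system T) (FF : ProperFilter F)
    (u v : T -> R[i]) (l m : R[i]) :
  ((u : T -> R[i]^o) @ F --> (l : R[i]^o)) ->
  ((v : T -> R[i]^o) @ F --> (m : R[i]^o)) ->
  (((fun k => u k - v k) : T -> R[i]^o) @ F --> (l - m : R[i]^o)).
Proof. by move=> h1 h2; exact: (cvgB h1 h2). Qed.

Lemma ccvg_shiftS (u : nat -> R[i]) (l : R[i]) :
  ((u : nat -> R[i]^o) @ \oo --> (l : R[i]^o)) ->
  (((fun n => u n.+1) : nat -> R[i]^o) @ \oo --> (l : R[i]^o)).
Proof.
move=> /ccvgP[h1 h2]; apply/ccvgP; split.
  by rewrite -(cvg_shiftS (Re \o u)) in h1.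
by rewrite -(cvg_shiftS (Im \o u)) in h2.
Qed.

Lemma cseriesZ (c : R[i]) (u : nat -> R[i]) : cseries_cvg u ->
  cseries_cvg (fun n => c * u n) /\ cseries (fun n => c * u n) = c * cseries u.
Proof.
move=> /cseries_cvgP h; apply: cseriesP.
rewrite [X in X @ _](_ : _ = (fun n => c * series (u : nat -> R[i]) n) :> (nat -> R[i]^o)).
  by apply: ccvgM; [exact: cvg_cst|exact: h].
by apply/funext => n; rewrite /series /= mulr_sumr.
Qed.

End complex_basics.

(** * Integrals of complex-valued functions *)

Section complex_integrals.
Context {R : realType}.
Implicit Types (D : set R) (f g : R -> R[i]).

Definition cmeasurable D f :=
  measurable_fun D (fun t => Re (f t)) /\ measurable_fun D (fun t => Im (f t)).

Lemma cmeasurable_cst D (c : R[i]) : cmeasurable D (fun=> c).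
Proof. by split; exact: measurable_cst. Qed.

Lemma cmeasurableM D f g : cmeasurable D f -> cmeasurable D g ->
  cmeasurable D (fun t => f t * g t).
Proof.
move=> [f1 f2] [g1 g2]; split.
  by under eq_fun do rewrite ReM; apply: measurable_funB; exact: measurable_funM.
by under eq_fun do rewrite ImM; apply: measurable_funD; exact: measurable_funM.
Qed.

Lemma cmeasurable_real D (h : R -> R) : measurable_fun D h ->
  cmeasurable D (fun t => (h t)%:C).
Proof. by move=> mh; split => //=; exact: measurable_cst. Qed.

Lemma eq_cmeasurable D f g : {in D, f =1 g} -> cmeasurable D f ->
  cmeasurable D g.
Proof.
move=> fg [f1 f2]; split.
  by apply: eq_measurable_fun f1 => t tD; rewrite fg.
by apply: eq_measurable_fun f2 => t tD; rewrite fg.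
Qed.

Lemma cmeasurable_lim D (f_ : nat -> R -> R[i]) f :
  (forall n, cmeasurable D (f_ n)) ->
  (forall t, D t -> (f_ ^~ t : nat -> R[i]^o) @ \oo --> (f t : R[i]^o)) ->
  measurable D -> cmeasurable D f.
Proof.
move=> mf fl mD; split.
  apply: (measurable_fun_cvg (h := fun n t => Re (f_ n t))) => //.
    by move=> n; case: (mf n).
  by move=> t /fl /ccvgP[].
apply: (measurable_fun_cvg (h := fun n t => Im (f_ n t))) => //.
  by move=> n; case: (mf n).
by move=> t /fl /ccvgP[].
Qed.

Lemma cintegrable_dominated D f (g : R -> R) : measurable D ->
  cmeasurable D f -> (forall t, D t -> normc (f t) <= g t) ->
  mu.-integrable D (EFin \o g) -> cintegrable D f.
Proof.
move=> mD [f1 f2] fg ig; split; apply: le_integrable ig => //.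
- exact/measurable_EFinP.
- move=> t Dt /=; rewrite lee_fin (le_trans (Re_le_normc _)) //.
  by rewrite (le_trans (fg _ Dt)) // ler_norm.
- exact/measurable_EFinP.
- move=> t Dt /=; rewrite lee_fin (le_trans (Im_le_normc _)) //.
  by rewrite (le_trans (fg _ Dt)) // ler_norm.
Qed.

Lemma cintegrable_measurable D f : cintegrable D f -> cmeasurable D f.
Proof.
move=> [f1 f2]; split; apply/measurable_EFinP.
  exact: measurable_int f1.
exact: measurable_int f2.
Qed.

Lemma cintegrable_normc D f : measurable D -> cintegrable D f ->
  mu.-integrable D (fun t => (normc (f t))%:E).
Proof.
move=> mD fi; have [m1 m2] := cintegrable_measurable fi.
have [f1 f2] := fi.
have i3 : mu.-integrable D (fun t => (`|Re (f t)| + `|Im (f t)|)%:E).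
  rewrite (_ : (fun t => _) = (fun t => (`|Re (f t)|)%:E) \+ (fun t => (`|Im (f t)|)%:E))%E.
    by apply: integrableD => //; exact: integrable_norm.
  by apply/funext => t /=; rewrite EFinD.
apply: le_integrable i3 => //.
- apply/measurable_EFinP.
  have -> : (fun t => normc (f t)) =
      (fun t => Num.sqrt ((Re (f t)) ^+ 2 + (Im (f t)) ^+ 2)).
    by apply/funext => t; case: (f t).
  apply: (measurableT_comp (f := @Num.sqrt R)).
    by apply: continuous_measurable_fun; exact: sqrt_continuous.
  by apply: measurable_funD; exact: measurable_funX.
- move=> t Dt /=; rewrite lee_fin ger0_norm ?normc_ge0 //.
  by rewrite ger0_norm ?addr_ge0 // normc_le_ReIm.
Qed.

Lemma cintegral_ReE D f : Re (cintegral D f) = \int[mu]_(t in D) Re (f t).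
Proof. by []. Qed.

Lemma cintegral_ImE D f : Im (cintegral D f) = \int[mu]_(t in D) Im (f t).
Proof. by []. Qed.

Lemma eq_cintegral D f g : {in D, f =1 g} -> cintegral D f = cintegral D g.
Proof.
by move=> fg; congr (_ +i* _); apply: eq_Rintegral => t tD; rewrite fg.
Qed.

Lemma cintegralD D f g : measurable D -> cintegrable D f -> cintegrable D g ->
  cintegrable D (fun t => f t + g t) /\
  cintegral D (fun t => f t + g t) = cintegral D f + cintegral D g.
Proof.
move=> mD [f1 f2] [g1 g2]; split.
  split.
    rewrite (_ : (fun t => _) = (fun t => (Re (f t))%:E) \+ (fun t => (Re (g t))%:E))%E.
      exact: integrableD.
    by apply/funext => t /=; rewrite ReD EFinD.
  rewrite (_ : (fun t => _) = (fun t => (Im (f t))%:E) \+ (fun t => (Im (g t))%:E))%E.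
    exact: integrableD.
  by apply/funext => t /=; rewrite ImD EFinD.
apply: complex_ext.
  rewrite ReD !cintegral_ReE -RintegralD //.
  by apply: eq_Rintegral => t _; rewrite ReD.
rewrite ImD !cintegral_ImE -RintegralD //.
by apply: eq_Rintegral => t _; rewrite ImD.
Qed.

Lemma cintegralZ D (c : R[i]) f : measurable D -> cintegrable D f ->
  cintegrable D (fun t => c * f t) /\
  cintegral D (fun t => c * f t) = c * cintegral D f.
Proof.
move=> mD [f1 f2].
have iZ (a : R) (h : R -> R) : mu.-integrable D (fun t => (h t)%:E) ->
    mu.-integrable D (fun t => (a * h t)%:E).
  move=> ih; rewrite (_ : (fun t => _) = (fun t => a%:E * (h t)%:E))%E.
    exact: integrableZl.
  by apply/funext => t /=; rewrite EFinM.
split.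
  split.
    rewrite (_ : (fun t => _) = (fun t => (Re c * Re (f t))%:E) \-
       (fun t => (Im c * Im (f t))%:E))%E.
      by apply: integrableB => //; exact: iZ.
    by apply/funext => t /=; rewrite ReM EFinB.
  rewrite (_ : (fun t => _) = (fun t => (Re c * Im (f t))%:E) \+
     (fun t => (Im c * Re (f t))%:E))%E.
    by apply: integrableD => //; exact: iZ.
  by apply/funext => t /=; rewrite ImM EFinD.
apply: complex_ext.
  rewrite ReM !cintegral_ReE !cintegral_ImE -!RintegralZl //.
  rewrite -RintegralB //; [|exact: iZ|exact: iZ].
  by apply: eq_Rintegral => t _; rewrite ReM.
rewrite ImM !cintegral_ReE !cintegral_ImE -!RintegralZl //.
rewrite -RintegralD //; [|exact: iZ|exact: iZ].
by apply: eq_Rintegral => t _; rewrite ImM.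
Qed.

Lemma cintegral0 D : cintegral D (fun=> 0) = 0.
Proof.
by apply: complex_ext; rewrite ?cintegral_ReE ?cintegral_ImE /Rintegral integral0.
Qed.

Lemma cintegrable0 D : cintegrable D (fun=> 0).
Proof. by split; exact: integrable0. Qed.

Lemma cintegral_sum D I (r : seq I) (F : I -> R -> R[i]) : measurable D ->
  (forall i, cintegrable D (F i)) ->
  cintegrable D (fun t => \sum_(i <- r) F i t) /\
  cintegral D (fun t => \sum_(i <- r) F i t) = \sum_(i <- r) cintegral D (F i).
Proof.
move=> mD iF; elim: r => [|i r [IH1 IH2]].
  under eq_fun do rewrite big_nil.
  by rewrite big_nil cintegral0; split => //; exact: cintegrable0.
under eq_fun do rewrite big_cons.
by rewrite big_cons -IH2; exact: cintegralD.
Qed.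

(** Bounding both components by the norm costs a factor 2, which is harmless
here and avoids rotating the integral onto the real axis. *)
Lemma cintegral_le D f (g : R -> R) : measurable D ->
  cintegrable D f -> (forall t, D t -> normc (f t) <= g t) ->
  mu.-integrable D (EFin \o g) ->
  normc (cintegral D f) <= 2 * \int[mu]_(t in D) g t.
Proof.
move=> mD [f1 f2] fg ig; apply: le_trans (normc_le_ReIm _) _.
rewrite mulr_natl mulr2n cintegral_ReE cintegral_ImE lerD //.
  apply: (@le_trans _ _ (\int[mu]_(t in D) `|Re (f t)|)).
    exact: le_normr_Rintegral.
  apply: le_Rintegral => //; first exact: integrable_norm.
  by move=> t Dt /=; apply: le_trans (Re_le_normc _) (fg _ Dt).
apply: (@le_trans _ _ (\int[mu]_(t in D) `|Im (f t)|)).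
    exact: le_normr_Rintegral.
apply: le_Rintegral => //; first exact: integrable_norm.
by move=> t Dt /=; apply: le_trans (Im_le_normc _) (fg _ Dt).
Qed.

(** Dominated convergence, in the form that serves every exchange of limit and
integral below: the majorant [g] bounds the norms of all the [f_ n]. *)
Lemma cintegral_cvg D (f_ : nat -> R -> R[i]) f (g : R -> R) :
  measurable D -> (forall n, cmeasurable D (f_ n)) ->
  (forall t, D t -> (f_ ^~ t : nat -> R[i]^o) @ \oo --> (f t : R[i]^o)) ->
  (forall n t, D t -> normc (f_ n t) <= g t) ->
  mu.-integrable D (EFin \o g) ->
  cintegrable D f /\
  ((fun n => cintegral D (f_ n)) : nat -> R[i]^o) @ \oo --> (cintegral D f : R[i]^o).
Proof.
move=> mD mf fl fg ig.
have [m1 m2] := cmeasurable_lim mf fl mD.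
have key (u_ : nat -> R -> R) (u : R -> R) : (forall n, measurable_fun D (u_ n)) ->
    measurable_fun D u -> (forall t, D t -> u_ ^~ t @ \oo --> u t) ->
    (forall n t, D t -> `|u_ n t| <= g t) ->
    mu.-integrable D (fun t => (u t)%:E) /\
    (fun n => \int[mu]_(t in D) u_ n t) @ \oo --> \int[mu]_(t in D) u t.
  move=> mu_ mu0 ul ug.
  have [|||||i1 _ i3] := @dominated_convergence _ _ _ mu D mD
    (fun n t => (u_ n t)%:E) (fun t => (u t)%:E) (EFin \o g).
  - by move=> n; apply/measurable_EFinP; exact: mu_.
  - by apply/measurable_EFinP; exact: mu0.
  - apply: aeW => t Dt; apply: cvg_EFin; last exact: ul.
    exact: nearW.
  - exact: ig.
  - by apply: aeW => t Dt n /=; rewrite lee_fin; exact: ug.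
  split => //; apply: fine_cvg.
  rewrite fineK //; exact: integrable_fin_num.
have [|||a1 a2] := key (fun n t => Re (f_ n t)) (fun t => Re (f t)) _ m1.
- by move=> n; case: (mf n).
- by move=> t /fl /ccvgP[].
- by move=> n t Dt; apply: le_trans (Re_le_normc _) (fg n t Dt).
have [|||b1 b2] := key (fun n t => Im (f_ n t)) (fun t => Im (f t)) _ m2.
- by move=> n; case: (mf n).
- by move=> t /fl /ccvgP[].
- by move=> n t Dt; apply: le_trans (Im_le_normc _) (fg n t Dt).
by split; [split|apply/ccvgP; split].
Qed.

(** Extending by 0 outside of [D] makes the change-of-variable and convolution
lemmas, stated on the whole line, available on any [D]. *)
Lemma cintegral_mkcond D f :
  cintegral D f = cintegral setT (fun t => if t \in D then f t else 0).
Proof.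
apply: complex_ext; rewrite ?cintegral_ReE ?cintegral_ImE Rintegral_mkcond.
  by apply: eq_Rintegral => t _; rewrite patchE; case: ifP.
by apply: eq_Rintegral => t _; rewrite patchE; case: ifP.
Qed.

Lemma cintegrable_mkcond D f : measurable D ->
  cintegrable D f <-> cintegrable setT (fun t => if t \in D then f t else 0).
Proof.
move=> mD.
have E1 : (fun t => (Re (if t \in D then f t else 0))%:E) = (fun t => (Re (f t))%:E) \_ D.
  by apply/funext => t; rewrite patchE; case: ifP.
have E2 : (fun t => (Im (if t \in D then f t else 0))%:E) = (fun t => (Im (f t))%:E) \_ D.
  by apply/funext => t; rewrite patchE; case: ifP.
rewrite /cintegrable E1 E2.
have [a1 a2] := @integrable_mkcond _ _ R mu D (fun t => (Re (f t))%:E) mD.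
have [b1 b2] := @integrable_mkcond _ _ R mu D (fun t => (Im (f t))%:E) mD.
by split=> -[h1 h2]; split; [exact: a1|exact: b1|exact: a2|exact: b2].
Qed.

End complex_integrals.

(** * Affine changes of variable and convolutions *)

Section affine_change.
Context {R : realType}.
Implicit Types (a b : R).
Local Notation muR := (@lebesgue_measure R).

Definition affine a b (x : measurableTypeR R) : measurableTypeR R := a * x + b.

Lemma measurable_affine a b : measurable_fun setT (affine a b).
Proof.
apply: (@continuous_measurable_fun R (fun x => a * x + b)) => x.
apply: cvgD; last exact: cvg_cst.
by apply: cvgM; [exact: cvg_cst|exact: cvg_id].
Qed.

(** Both sides are measures that agree on half-open intervals. *)
Lemma lebesgue_measure_affine a b (A : set R) (a0 : 0 < a) : measurable A ->
  muR A = (a%:E * muR (affine a b @^-1` A))%E.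
Proof.
move=> mA.
pose m := mscale (NngNum (ltW a0)) (pushforward muR (affine a b)).
have -> : (a%:E * muR (affine a b @^-1` A))%E = m (measurable_affine a b) A by [].
apply: lebesgue_measure_unique => //=.
move=> _ [[x y]] _ <-.
rewrite /m /mscale /= /pushforward.
have -> : affine a b @^-1` `]x, y]%classic = `](x - b) / a, (y - b) / a]%classic.
  apply/seteqP; split=> t /=; rewrite /affine !in_itv /=;
    by rewrite ltr_pdivrMr // ler_pdivlMr // ltrBlDr lerBrDr mulrC.
rewrite !lebesgue_measure_itv /= !lte_fin ltr_pM2r ?invr_gt0 // ltrD2r.
case: ifP => xy; last by rewrite mule0.
rewrite -!EFinB -EFinM; congr EFin; field.
exact: lt0r_neq0.
Qed.

Lemma ge0_integral_affine a b (f : R -> \bar R) (a0 : 0 < a) :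
  measurable_fun setT f -> (forall x, 0 <= f x)%E ->
  (\int[mu]_x f x = a%:E * \int[mu]_x f (a * x + b)%R)%E.
Proof.
move=> mf f0.
pose m := mscale (NngNum (ltW a0)) (pushforward muR (affine a b)).
transitivity (\int[m (measurable_affine a b)]_x f x)%E.
  by apply: eq_measure_integral => A mA _; exact: lebesgue_measure_affine.
rewrite ge0_integral_mscale //=; congr (_ * _)%E.
by rewrite ge0_integral_pushforward //; exact: measurable_affine.
Qed.

Lemma integrable_affine a b (f : R -> R) (a0 : 0 < a) :
  muR.-integrable setT (fun x => (f x)%:E) ->
  muR.-integrable setT (fun x => (f (a * x + b))%:E).
Proof.
move=> /integrableP[mf fi]; apply/integrableP; split.
  exact: measurableT_comp mf (measurable_affine a b).
move: fi; rewrite (ge0_integral_affine b a0) //=; last first.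
  exact: (measurableT_comp (@abse_measurable R setT) mf).
apply: contraTT; rewrite -!leNgt !leye_eq => /eqP ->.
by rewrite gt0_muley ?lte_fin.
Qed.

Lemma Rintegral_affine a b (f : R -> R) (a0 : 0 < a) :
  muR.-integrable setT (fun x => (f x)%:E) ->
  \int[mu]_x f x = a * \int[mu]_x f (a * x + b).
Proof.
move=> fi; have fi' := integrable_affine b a0 fi.
have [mf _] := integrableP _ _ _ fi.
have [mf' _] := integrableP _ _ _ fi'.
pose F x := (f x)%:E; pose G x := (f (a * x + b))%:E.
have EP : (\int[muR]_x F^\+ x = a%:E * \int[muR]_x G^\+ x)%E.
  rewrite (_ : funepos G = fun x => funepos F (a * x + b)); last exact: (funepos_comp F (affine a b)).
  by rewrite -(@ge0_integral_affine a b (funepos F)) //; exact: measurable_funepos.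
have EN : (\int[muR]_x F^\- x = a%:E * \int[muR]_x G^\- x)%E.
  rewrite (_ : funeneg G = fun x => funeneg F (a * x + b)); last exact: (funeneg_comp F (affine a b)).
  by rewrite -(@ge0_integral_affine a b (funeneg F)) //; exact: measurable_funeneg.
have fG : (\int[muR]_x G x)%E \is a fin_num by exact: integrable_fin_num.
rewrite -[a]/(fine a%:E) -fineM //; congr fine.
rewrite [LHS]integralE [X in _ = (_ * X)%E]integralE -/F -/G.
have fP : (\int[muR]_x G^\+ x)%E \is a fin_num.
  by apply: integrable_fin_num => //; exact: integrable_funepos.
by rewrite muleBr ?fin_num_adde_defr // -EP -EN.
Qed.

Lemma integrable_opp (f : R -> R) :
  muR.-integrable setT (fun x => (f x)%:E) ->
  muR.-integrable setT (fun x => (f (- x))%:E).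
Proof.
move=> /integrableP[mf fi]; apply/integrableP.
have mN : measurable_fun setT (-%R : measurableTypeR R -> measurableTypeR R).
  exact: oppr_measurable.
split; first exact: measurableT_comp mf mN.
apply: le_lt_trans fi.
rewrite -(@ge0_integral_pushforward _ _ _ _ R _ mN muR setT (fun x => `|(f x)%:E|%E)) //=.
  by rewrite le_eqVlt; apply/orP; left; apply/eqP; apply: eq_measure_integral => A mA _; exact: lebesgue_measureN.
exact: (measurableT_comp (@abse_measurable R setT) mf).
Qed.

Lemma cintegrable_affine a b (f : R -> R[i]) (a0 : 0 < a) :
  cintegrable setT f -> cintegrable setT (fun x => f (a * x + b)).
Proof.
move=> [f1 f2]; split.
  exact: (@integrable_affine a b (fun x => Re (f x))).
exact: (@integrable_affine a b (fun x => Im (f x))).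
Qed.

Lemma cintegral_affine a b (f : R -> R[i]) (a0 : 0 < a) :
  cintegrable setT f ->
  cintegral setT f = a%:C * cintegral setT (fun x => f (a * x + b)).
Proof.
move=> [f1 f2].
have E1 := @Rintegral_affine a b (fun x => Re (f x)) a0 f1.
have E2 := @Rintegral_affine a b (fun x => Im (f x)) a0 f2.
apply: complex_ext; rewrite ?ReM ?ImM /= mul0r ?subr0 ?addr0; [exact: E1|exact: E2].
Qed.

Local Open Scope ereal_scope.

Lemma integrable_convolution (f g : R -> R) :
  (forall x, 0 <= f x)%R -> (forall x, 0 <= g x)%R ->
  muR.-integrable setT (EFin \o f) -> muR.-integrable setT (EFin \o g) ->
  (muR \x muR).-integrable setT (fun z => (f z.1 * g (z.2 - z.1))%:E).
Proof.
move=> f0 g0 fi gi.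
have mf : measurable_fun setT f by apply/measurable_EFinP; case/integrableP : fi.
have mg : measurable_fun setT g by apply/measurable_EFinP; case/integrableP : gi.
have [mf' _] := integrableP _ _ _ fi.
have [mg' _] := integrableP _ _ _ gi.
have mH : measurable_fun setT (fun z : measurableTypeR R * measurableTypeR R =>
    (f z.1 * g (z.2 - z.1))%:E).
  apply/measurable_EFinP; apply: measurable_funM.
    exact: measurableT_comp mf measurable_fst.
  apply: measurableT_comp mg _.
  by apply: measurable_funB; [exact: measurable_snd|exact: measurable_fst].
apply/integrable12ltyP => //=.
have -> : (\int[muR]_x \int[muR]_y `|(f x * g (y - x))%:E|) =
   \int[muR]_x ((f x)%:E * \int[muR]_y (g y)%:E).
  apply: eq_integral => x _.
  rewrite (@ge0_integral_affine 1 (- x) (fun y => (g y)%:E)) //.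
  rewrite mul1e -ge0_integralZl //; last 3 first.
  - exact: measurableT_comp mg' (measurable_affine 1 (- x)).
  - by move=> y _; rewrite lee_fin.
  - by rewrite lee_fin.
  apply: eq_integral => y _.
  by rewrite -EFinM mul1r gee0_abs // lee_fin mulr_ge0.
have fg : \int[muR]_y (g y)%:E \is a fin_num by exact: integrable_fin_num.
have -> : \int[muR]_x ((f x)%:E * \int[muR]_y (g y)%:E) =
    \int[muR]_x (f x)%:E * \int[muR]_y (g y)%:E.
  apply: ge0_integralZr => //.
    by move=> y _; rewrite lee_fin.
  by apply: integral_ge0 => y _; rewrite lee_fin.
have ff : \int[muR]_y (f y)%:E \is a fin_num by exact: integrable_fin_num.
apply: lte_mul_pinfty; [|exact: ff|]; first by apply: integral_ge0 => y _; rewrite lee_fin.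
by rewrite ltey_eq fg.
Qed.

Local Close Scope ereal_scope.

(** Fubini makes the inner integral run over [v], where translation invariance
removes [s].  The integral over [s] may diverge for [v] in a null set; [fine]
then returns 0, which the outer integral does not see. *)
Lemma cintegral_convolution (f g : R -> R[i]) :
  cintegrable setT f -> cintegrable setT g ->
  cintegral setT (fun v => cintegral setT (fun s => f s * g (v - s))) =
  cintegral setT f * cintegral setT g.
Proof.
move=> fi gi.
have mT : measurable [set: measurableTypeR R] by [].
have [mf1 mf2] := cintegrable_measurable fi.
have [mg1 mg2] := cintegrable_measurable gi.
have iK := integrable_convolution (fun x => normc_ge0 (f x))
  (fun x => normc_ge0 (g x)) (cintegrable_normc mT fi) (cintegrable_normc mT gi).
have m1 (h : R -> R) : measurable_fun setT h ->
    measurable_fun setT (fun z : measurableTypeR R * measurableTypeR R => h z.1).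
  by move=> mh; exact: measurableT_comp mh measurable_fst.
have m2 (h : R -> R) : measurable_fun setT h ->
    measurable_fun setT (fun z : measurableTypeR R * measurableTypeR R => h (z.2 - z.1)).
  move=> mh; apply: measurableT_comp mh _.
  by apply: measurable_funB; [exact: measurable_snd|exact: measurable_fst].
have shift s : cintegrable setT (fun v => g (v - s)) /\
    cintegral setT (fun v => g (v - s)) = cintegral setT g.
  have e : (fun v => g (1 * v + - s)) = (fun v => g (v - s)).
    by apply/funext => v; rewrite mul1r.
  rewrite -e (cintegral_affine (- s) ltr01 gi) mul1r; split => //.
  exact: cintegrable_affine.
have key (p : R[i] -> R) : (forall z, `|p z| <= normc z) ->
    measurable_fun setT (fun z : measurableTypeR R * measurableTypeR R =>
      p (f z.1 * g (z.2 - z.1))) ->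
    \int[mu]_v \int[mu]_s p (f s * g (v - s)) =
    \int[mu]_s \int[mu]_v p (f s * g (v - s)).
  move=> pn mp.
  pose H (z : measurableTypeR R * measurableTypeR R) := (p (f z.1 * g (z.2 - z.1)))%:E.
  have iH : (muR \x muR)%E.-integrable setT H.
    apply: le_integrable iK => //; first exact/measurable_EFinP.
    move=> [s v] _ /=; rewrite lee_fin (le_trans (pn _)) //.
    by rewrite ComplexField.Normc.normcM ger0_norm // mulr_ge0 // normc_ge0.
  have fin_ae (F : R -> \bar R) : muR.-integrable setT F ->
      \int[mu]_x fine (F x) = fine (\int[muR]_x F x)%E.
    move=> iF; congr fine; apply: ae_eq_integral => //.
    - apply/measurable_EFinP; apply: measurableT_comp; last exact: measurable_int iF.
      exact: fine_measurable.
    - exact: measurable_int iF.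
    - apply: filterS (integrable_ae measurableT iF) => x h _.
      by rewrite fineK // h.
  have iG : muR.-integrable setT (fubini_G muR H).
    have mH := measurable_int _ iH.
    have mG := measurable_fubini_G iH.
    apply/integrableP; split; first exact: mG.
    apply: le_lt_trans ((integrable21ltyP _ _ mH).1 iH).
    apply: ge0_le_integral => //.
    - exact: (measurableT_comp (@abse_measurable R setT) mG).
    - apply: (measurable_fun_fubini_tonelli_G (m1 := muR) (fun z => `|H z|%E)) => //=.
      exact: (measurableT_comp (@abse_measurable R setT) mH).
    - move=> v _; apply: le_abse_integral => //.
      exact: measurableT_comp mH (pair2_measurable v).
  rewrite /Rintegral in fin_ae *.
  apply: (etrans (fin_ae _ iG)).
  apply: (etrans _ (esym (fin_ae _ (integrable_fubini_F iH)))).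
  exact: (congr1 fine (esym (Fubini iH))).
have fg s : cintegral setT (fun v => f s * g (v - s)) = f s * cintegral setT g.
  have [h1 h2] := shift s.
  by have [_ ->] := cintegralZ (f s) mT h1; rewrite h2.
transitivity (cintegral setT (fun s => cintegral setT (fun v => f s * g (v - s)))).
  apply: complex_ext.
    apply: (key (fun z => Re z)); first exact: Re_le_normc.
    under eq_fun do rewrite ReM.
    apply: measurable_funB; apply: measurable_funM;
      [exact: (m1 _ mf1)|exact: (m2 _ mg1)|exact: (m1 _ mf2)|exact: (m2 _ mg2)].
  apply: (key (fun z => Im z)); first exact: Im_le_normc.
  under eq_fun do rewrite ImM.
  apply: measurable_funD; apply: measurable_funM;
    [exact: (m1 _ mf1)|exact: (m2 _ mg2)|exact: (m1 _ mf2)|exact: (m2 _ mg1)].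
under eq_cintegral do rewrite fg.
under eq_cintegral do rewrite mulrC.
have [_ ->] := cintegralZ (cintegral setT g) mT fi.
by rewrite mulrC.
Qed.

End affine_change.

(** * The complex exponential and derivatives along the real line *)

Section complex_exponential.
Context {R : realType}.
Implicit Types (z w : R[i]) (t : R).

Lemma Re_cexp z : Re (cexp z) = expR (Re z) * cos (Im z).
Proof. by rewrite /cexp ReM /= mul0r subr0. Qed.

Lemma Im_cexp z : Im (cexp z) = expR (Re z) * sin (Im z).
Proof. by rewrite /cexp ImM /= mul0r addr0. Qed.

Lemma cexpD z w : cexp (z + w) = cexp z * cexp w.
Proof.
apply: complex_ext.
  by rewrite Re_cexp ReM !Re_cexp !Im_cexp ReD ImD expRD cosD; ring.
by rewrite Im_cexp ImM !Re_cexp !Im_cexp ReD ImD expRD sinD; ring.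
Qed.

Lemma cexp_real t : cexp t%:C = (expR t)%:C.
Proof. by apply: complex_ext; rewrite ?Re_cexp ?Im_cexp /= ?cos0 ?sin0 ?mulr1 ?mulr0. Qed.

Lemma cexp0 : cexp (0 : R[i]) = 1.
Proof. by rewrite -[0 : R[i]]/((0 : R)%:C) cexp_real expR0. Qed.

Lemma normc_cexp z : normc (cexp z) = expR (Re z).
Proof.
apply/eqP; rewrite -(@eqrXn2 _ 2) ?normc_ge0 ?expR_ge0 //.
by rewrite sqr_normcE Re_cexp Im_cexp !exprMn -mulrDr cos2Dsin2 mulr1.
Qed.

Lemma cexp_neq0 z : cexp z != 0.
Proof. by rewrite -normc_gt0 normc_cexp expR_gt0. Qed.

Lemma cexpN z : cexp (- z) = (cexp z)^-1.
Proof.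
apply: (mulfI (cexp_neq0 z)).
by rewrite -cexpD subrr cexp0 divff // cexp_neq0.
Qed.

(** Every derivative below is along the real line, where it may be taken
componentwise. *)
Definition is_cderive (f : R -> R[i]) t (d : R[i]) :=
  is_derive t 1 (fun u => Re (f u)) (Re d) /\
  is_derive t 1 (fun u => Im (f u)) (Im d).

Lemma is_cderive_cst t (c : R[i]) : is_cderive (fun=> c) t 0.
Proof. by split; exact: is_derive_cst. Qed.

Lemma is_cderive_id t : is_cderive (fun u => u%:C) t 1.
Proof. by split; [exact: is_derive_id|exact: is_derive_cst]. Qed.

Lemma is_derive_ext t (f g : R -> R) (d e : R) : f =1 g -> d = e ->
  is_derive t 1 f d -> is_derive t 1 g e.
Proof. by move=> /funext -> ->. Qed.

Lemma is_cderiveD t f g (d e : R[i]) : is_cderive f t d -> is_cderive g t e ->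
  is_cderive (fun u => f u + g u) t (d + e).
Proof.
move=> [f1 f2] [g1 g2]; split.
  apply: is_derive_ext (is_deriveD f1 g1); last by rewrite ReD.
  by move=> u /=; rewrite ReD.
apply: is_derive_ext (is_deriveD f2 g2); last by rewrite ImD.
by move=> u /=; rewrite ImD.
Qed.

Lemma is_cderiveM t f g (d e : R[i]) : is_cderive f t d -> is_cderive g t e ->
  is_cderive (fun u => f u * g u) t (d * g t + f t * e).
Proof.
move=> [f1 f2] [g1 g2]; split.
  apply: is_derive_ext (is_deriveB (is_deriveM f1 g1) (is_deriveM f2 g2)).
    by move=> u /=; rewrite ReM.
  by rewrite ReD !ReM /GRing.scale /=; ring.
apply: is_derive_ext (is_deriveD (is_deriveM f1 g2) (is_deriveM f2 g1)).
  by move=> u /=; rewrite ImM.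
by rewrite ImD !ImM /GRing.scale /=; ring.
Qed.

Lemma is_cderiveZ t f (c d : R[i]) : is_cderive f t d ->
  is_cderive (fun u => c * f u) t (c * d).
Proof.
move=> fd; have := is_cderiveM (is_cderive_cst t c) fd.
by rewrite mul0r add0r.
Qed.

Lemma is_cderive_cexp t f (d : R[i]) : is_cderive f t d ->
  is_cderive (fun u => cexp (f u)) t (cexp (f t) * d).
Proof.
move=> [f1 f2].
have e1 := is_derive1_comp (is_derive_expR (Re (f t))) f1.
have c1 := is_derive1_comp (is_derive_cos (Im (f t))) f2.
have s1 := is_derive1_comp (is_derive_sin (Im (f t))) f2.
split.
  apply: is_derive_ext (is_deriveM e1 c1).
    by move=> u; rewrite [RHS]Re_cexp.
  by rewrite ReM Re_cexp Im_cexp /GRing.scale /=; ring.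
apply: is_derive_ext (is_deriveM e1 s1).
  by move=> u; rewrite [RHS]Im_cexp.
by rewrite ImM Re_cexp Im_cexp /GRing.scale /=; ring.
Qed.

Lemma is_cderive_ln t : 0 < t -> is_cderive (fun u => (ln u)%:C) t (t^-1)%:C.
Proof. by move=> t0; split; [exact: is_derive1_ln|exact: is_derive_cst]. Qed.

Lemma is_derive_continuous (f : R -> R) t d : is_derive t 1 f d ->
  {for t, continuous f}.
Proof. by move=> [fd _]; apply: differentiable_continuous; exact/derivable1_diffP. Qed.

(** Differentiability of [f] is asked for only because it gives continuity. *)
Lemma cintegral_FTC (F f : R -> R[i]) (a b : R) : a < b ->
  (forall t, t \in `[a, b] -> is_cderive F t (f t)) ->
  (forall t, t \in `[a, b] -> exists d, is_cderive f t d) ->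
  cintegral `[a, b] f = F b - F a.
Proof.
move=> ab dF df.
have sub t : t \in `]a, b[ -> t \in `[a, b] by exact: subset_itv_oo_cc.
have key (G g : R -> R) : (forall t, t \in `[a, b] -> is_derive t 1 G (g t)) ->
    (forall t, t \in `[a, b] -> {for t, continuous g}) ->
    \int[mu]_(t in `[a, b]) g t = G b - G a.
  move=> dG cg.
  rewrite /Rintegral (@continuous_FTC2 _ g G) //.
  - by apply: continuous_in_subspaceT => t; rewrite inE => /cg.
  - have cG t : t \in `[a, b] -> {for t, continuous G}.
      by move=> /dG; exact: is_derive_continuous.
    split.
    + by move=> t /sub /dG[].
    + by apply: cvg_at_right_filter; apply: cG; rewrite in_itv /= lexx ltW.
    + by apply: cvg_at_left_filter; apply: cG; rewrite in_itv /= lexx ltW.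
  - by move=> t /sub /dG h; rewrite derive1E; exact: derive_val.
apply: complex_ext; rewrite ?ReB ?ImB ?cintegral_ReE ?cintegral_ImE.
  apply: (key (fun t => Re (F t)) (fun t => Re (f t))).
    by move=> t /dF[].
  by move=> t /df[d []] /is_derive_continuous.
apply: (key (fun t => Im (F t)) (fun t => Im (f t))).
  by move=> t /dF[].
by move=> t /df[d []] _ /is_derive_continuous.
Qed.

End complex_exponential.

(** * Complex powers of positive reals *)

Section power_kernels.
Context {R : realType}.
Implicit Types (z w : R[i]) (t x y : R).
Local Notation muR := (@lebesgue_measure R).

Lemma cpow_gt0 t z : 0 < t -> cpow t%:C z = cexp (z * (ln t)%:C).
Proof.
move=> t0; rewrite /cpow ifF; last first.
  by apply/negbTE; rewrite -normc_gt0 normcR gtr0_norm.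
congr (cexp (_ * _)); rewrite /clog /carg normcR gtr0_norm //.
by rewrite /= lexx divff ?gt_eqF // acos1.
Qed.

(** The function [t ^ (z - 1)] on ]0, +oo[, extended by 0 so that convolutions
and dilations can be taken over the whole line. *)
Definition power_kernel z t : R[i] :=
  if 0 < t then cexp ((z - 1) * (ln t)%:C) else 0.

Lemma cmeasurable_cexp (D : set R) (f : R -> R[i]) :
  cmeasurable D f -> cmeasurable D (fun t => cexp (f t)).
Proof.
move=> [f1 f2]; split.
  under eq_fun do rewrite Re_cexp.
  apply: measurable_funM.
    exact: measurableT_comp (@measurable_expR R) f1.
  apply: measurableT_comp f2; apply: continuous_measurable_fun.
  exact: continuous_cos.
under eq_fun do rewrite Im_cexp.
apply: measurable_funM.
  exact: measurableT_comp (@measurable_expR R) f1.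
apply: measurableT_comp f2; apply: continuous_measurable_fun.
exact: continuous_sin.
Qed.

Lemma cmeasurable_ifP (P : R -> bool) (f : R -> R[i]) :
  measurable [set t | P t] -> cmeasurable setT f ->
  cmeasurable setT (fun t => if P t then f t else 0).
Proof.
move=> mP mf.
have mI : cmeasurable setT (fun t => (\1_[set t | P t] t : R)%:C).
  by apply: cmeasurable_real; exact: measurable_indic.
apply: eq_cmeasurable (cmeasurableM mI mf) => t _.
rewrite indicE mem_setE unfold_in; case: (P t).
  by rewrite -[X in X * _]/(1 : R[i]) mul1r.
by rewrite -[X in X * _]/(0 : R[i]) mul0r.
Qed.

Lemma cmeasurable_power_kernel z : cmeasurable setT (power_kernel z).
Proof.
apply: cmeasurable_ifP.
  rewrite (_ : [set _ | _] = `]0, +oo[%classic); first exact: measurable_itv.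
  by apply/seteqP; split => t /=; rewrite in_itv /= andbT.
apply: cmeasurable_cexp; apply: cmeasurableM; first exact: cmeasurable_cst.
by apply: cmeasurable_real; exact: measurable_ln.
Qed.

Lemma normc_power_kernel z t :
  normc (power_kernel z t) = if 0 < t then expR ((Re z - 1) * ln t) else 0.
Proof.
rewrite /power_kernel; case: ifP => _; last exact: ComplexField.Normc.normc0.
by rewrite normc_cexp ReM ReB /= mulr0 subr0.
Qed.

Lemma power_kernelM z v t : 0 < v ->
  power_kernel z (v * t) = cexp ((z - 1) * (ln v)%:C) * power_kernel z t.
Proof.
move=> v0; rewrite /power_kernel pmulr_rgt0 //.
case: ifP => t0; last by rewrite mulr0.
by rewrite -cexpD lnM ?posrE // rmorphD mulrDr.
Qed.

Lemma is_cderive_power z t : 0 < t ->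
  is_cderive (fun u => cexp (z * (ln u)%:C)) t (z * cexp ((z - 1) * (ln t)%:C)).
Proof.
move=> t0.
have h := is_cderive_cexp (is_cderiveZ z (is_cderive_ln t0)).
have -> // : z * cexp ((z - 1) * (ln t)%:C) = cexp (z * (ln t)%:C) * (z * (t^-1)%:C).
rewrite mulrBl mul1r cexpD cexpN cexp_real lnK ?posrE //.
by rewrite fmorphV; ring.
Qed.

Lemma cintegral_power z (a b : R) : 0 < a < b ->
  cintegral `[a, b] (fun t => z * cexp ((z - 1) * (ln t)%:C)) =
  cexp (z * (ln b)%:C) - cexp (z * (ln a)%:C).
Proof.
move=> /andP[a0 ab].
have pos t : t \in `[a, b] -> 0 < t.
  by rewrite in_itv /= => /andP[at_ _]; exact: lt_le_trans at_.
apply: (cintegral_FTC (F := fun t => cexp (z * (ln t)%:C))) => //.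
  by move=> t /pos; exact: is_cderive_power.
move=> t /pos t0; eexists; apply: is_cderiveZ.
exact: is_cderive_power.
Qed.

(** On [1 / (n + 2), 1] the integral is at most [1 / x] by the fundamental
theorem of calculus; monotone convergence passes to ]0, 1]. *)
Lemma integrable_unit_power x : 0 < x ->
  muR.-integrable setT
    (fun t => (if 0 < t <= 1 then expR ((x - 1) * ln t) else 0)%:E).
Proof.
move=> x0.
pose f t := expR ((x - 1) * ln t).
have mf : measurable_fun setT f.
  apply: measurableT_comp (@measurable_expR R) _.
  apply: measurable_funM; first exact: measurable_cst.
  exact: measurable_ln.
have -> : (fun t => (if 0 < t <= 1 then expR ((x - 1) * ln t) else 0)%:E) =
    (fun t => (f t)%:E) \_ `]0, 1].
  apply/funext => t; rewrite patchE mem_setE in_itv /=.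
  by case: ifP.
apply/(@integrable_mkcond _ _ R muR `]0%R, 1%R]%classic (fun t => (f t)%:E)) => //.
have mEf (D : set R) : measurable_fun D (fun t => (f t)%:E).
  by apply/measurable_EFinP; exact: measurable_funTS.
apply/integrableP; split; first exact: mEf.
have -> : (\int[muR]_(t in `]0%R, 1%R]) `|(f t)%:E| = \int[muR]_(t in `]0%R, 1%R]) (f t)%:E)%E.
  by apply: eq_integral => t _; rewrite gee0_abs // lee_fin expR_ge0.
pose F n := `[n.+2%:R^-1, 1 : R]%classic.
have F0 n : (0 : R) < n.+2%:R^-1 by rewrite invr_gt0.
have UF : \bigcup_n F n = `]0%R, 1%R]%classic.
  apply/seteqP; split => t /=.
    move=> [n _] /=; rewrite /F /= !in_itv /= => /andP[h ->].
    by rewrite andbT; exact: lt_le_trans h.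
  rewrite in_itv /= => /andP[t0 t1].
  exists (Num.truncn t^-1) => //; rewrite /F /= in_itv /= t1 andbT.
  rewrite invf_ple ?posrE // ltW //.
  have := truncnS_gt t^-1; move=> /lt_trans; apply.
  by rewrite ltr_nat.
have := @ge0_nondecreasing_set_cvg_integral _ (measurableTypeR R) R F (fun t => (f t)%:E) muR.
rewrite UF => cvgF.
apply: (@le_lt_trans _ _ (x^-1)%:E); last exact: ltry.
pose G t := x^-1 * expR (x * ln t).
have dG t : 0 < t -> is_derive t 1 G (f t).
  move=> t0.
  have h := is_derive1_comp (g := fun u => x * ln u) (is_derive_expR (x * ln t))
    (is_deriveZ x (is_derive1_ln t0)).
  apply: is_derive_ext (is_deriveZ x^-1 h) => //.
  rewrite /GRing.scale /= /f mulrBl mul1r expRD expRN lnK ?posrE //.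
  by field; rewrite !gt_eqF.
have cf t : 0 < t -> {for t, continuous f}.
  move=> t0; apply: (continuous_comp (f := fun u => (x - 1) * ln u)).
    by apply: cvgM; [exact: cvg_cst|exact: continuous_ln].
  exact: continuous_expR.
have F1 n : (\int[muR]_(t in F n) (f t)%:E <= (x^-1)%:E)%E.
  have pos t : n.+2%:R^-1 <= t -> 0 < t by exact: lt_le_trans.
  rewrite (@continuous_FTC2 _ f G) //.
  - by rewrite /G ln1 mulr0 expR0 mulr1 -EFinB lee_fin gerBl mulr_ge0 ?expR_ge0 // invr_ge0 ltW.
  - by rewrite invf_lt1 // ltr1n.
  - apply: continuous_in_subspaceT => t; rewrite inE /= in_itv /= => /andP[/pos + _].
    exact: cf.
  - have cG t : 0 < t -> {for t, continuous G} by move=> /dG; exact: is_derive_continuous.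
    split.
    + by move=> t; rewrite in_itv /= => /andP[/ltW/pos/dG[]].
    + by apply: cvg_at_right_filter; exact: cG.
    + by apply: cvg_at_left_filter; exact: cG.
  - move=> t; rewrite in_itv /= => /andP[/ltW/pos/dG h _].
    by rewrite derive1E; exact: derive_val.
have {}cvgF : (\int[muR]_(x in F i) (f x)%:E)%E @[i --> \oo] -->
    (\int[muR]_(x in `]0%R, 1%R]) (f x)%:E)%E.
  apply: cvgF => //.
  - apply/nondecreasing_seqP => n; rewrite subsetEset /F.
    apply: subset_itvr; rewrite bnd_simp lef_pV2 ?posrE // ler_nat //.
  - by move=> i; exact: measurable_itv.
  - by move=> i; exact: mEf.
  - by move=> i t _; rewrite lee_fin expR_ge0.
rewrite -(cvg_lim (@ereal_hausdorff _) cvgF).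
by apply: lime_le; [apply/cvg_ex; eexists; exact: cvgF|exact: nearW].
Qed.

End power_kernels.

(** * Euler's integrals *)

Section gamma_function.
Context {R : realType}.
Implicit Types (z w : R[i]) (t x y : R).
Local Notation muR := (@lebesgue_measure R).

Let mT : measurable [set: measurableTypeR R]. Proof. by []. Qed.

Definition gamma_kernel z t : R[i] := power_kernel z t * (expR (- t))%:C.

Definition beta_kernel z w t : R[i] := power_kernel z t * power_kernel w (1 - t).

Definition beta_integral z w : R[i] := cintegral setT (beta_kernel z w).

Lemma cmeasurable_gamma_kernel z : cmeasurable setT (gamma_kernel z).
Proof.
apply: cmeasurableM; first exact: cmeasurable_power_kernel.
apply: cmeasurable_real; apply: measurableT_comp (@measurable_expR R) _.
exact: oppr_measurable.
Qed.

Lemma cmeasurable_beta_kernel z w : cmeasurable setT (beta_kernel z w).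
Proof.
apply: cmeasurableM; first exact: cmeasurable_power_kernel.
have [m1 m2] := cmeasurable_power_kernel w.
have mB : measurable_fun setT (fun t : R => 1 - t).
  by apply: measurable_funB; [exact: measurable_cst|exact: measurable_id].
by split; [exact: measurableT_comp m1 mB|exact: measurableT_comp m2 mB].
Qed.

Lemma integrableZD (a b : R) (f g : R -> R) :
  muR.-integrable setT (EFin \o f) -> muR.-integrable setT (EFin \o g) ->
  muR.-integrable setT (fun t => (a * f t + b * g t)%:E).
Proof.
move=> fi gi.
rewrite (_ : (fun t => _) = (fun t => a%:E * (f t)%:E) \+ (fun t => b%:E * (g t)%:E))%E.
  by apply: integrableD => //; exact: integrableZl.
by apply/funext => t; rewrite EFinD !EFinM.
Qed.

(** From [ln t = ln (2 c) + ln (t / (2 c)) <= ln (2 c) + t / (2 c)]: half of the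
exponential decay absorbs the power. *)
Lemma power_expR_bound x t : 1 <= t ->
  expR ((x - 1) * ln t) * expR (- t) <=
  expR ((`|x - 1| + 1) * ln (2 * (`|x - 1| + 1))) * expR (- 2^-1 * t).
Proof.
move=> t1; set c := `|x - 1| + 1.
have c0 : 0 < c by rewrite ltr_wpDl.
have t0 : 0 < t by exact: lt_le_trans t1.
rewrite -!expRD ler_expR.
have h1 : (x - 1) * ln t <= c * ln t.
  by rewrite ler_wpM2r ?ln_ge0 // (le_trans (ler_norm _)) // lerDl.
have h2 : c * ln t <= c * ln (2 * c) + 2^-1 * t.
  have -> : ln t = ln (2 * c) + ln (t / (2 * c)).
    rewrite -lnM ?posrE ?divr_gt0 ?mulr_gt0 //.
    by rewrite mulrC divfK // gt_eqF ?mulr_gt0.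
  rewrite mulrDr lerD2l.
  have h : ln (t / (2 * c)) <= t / (2 * c).
    by apply/ltW/ln_sublinear; rewrite divr_gt0 ?mulr_gt0.
  apply: le_trans (ler_wpM2l (ltW c0) h) _.
  by rewrite le_eqVlt; apply/orP; left; apply/eqP; field; rewrite gt_eqF.
have -> : c * ln (2 * c) + - 2^-1 * t = c * ln (2 * c) + 2^-1 * t - t by field.
by rewrite lerD2r (le_trans h1).
Qed.

Lemma cintegrable_gamma_kernel z : 0 < Re z -> cintegrable setT (gamma_kernel z).
Proof.
move=> z0.
set x := Re z in z0.
have i2 : muR.-integrable setT (EFin \o exponential_pdf (2^-1 : R)).
  exact: integrable_exponential_pdf.
set C := expR ((`|x - 1| + 1) * ln (2 * (`|x - 1| + 1))).
apply: cintegrable_dominated (integrableZD 1 (2 * C) (integrable_unit_power z0) i2) => //.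
  exact: cmeasurable_gamma_kernel.
move=> t _; rewrite /gamma_kernel ComplexField.Normc.normcM normc_power_kernel.
rewrite normcR gtr0_norm ?expR_gt0 // -/x.
have [t0|t0] := ltP 0 t; last first.
  by rewrite !mul0r mulr0 add0r !mulr_ge0 ?expR_ge0 // exponential_pdf_ge0.
have [t1|t1] := leP t 1.
  rewrite /= mul1r ler_wpDr //.
    by rewrite !mulr_ge0 ?expR_ge0 // exponential_pdf_ge0.
  by rewrite ler_piMr ?expR_ge0 // expR_le1 oppr_le0 ltW.
rewrite /= mulr0 add0r (le_trans (power_expR_bound _ (ltW t1))) // -/C.
rewrite exponential_pdfE ?(ltW t0) //.
by rewrite le_eqVlt; apply/orP; left; apply/eqP; field.
Qed.

Lemma power_bound_half y t : 2^-1 <= t <= 1 ->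
  expR ((y - 1) * ln t) <= expR (`|y - 1| * ln 2).
Proof.
move=> /andP[t1 t2]; rewrite ler_expR.
have t0 : 0 < t by apply: lt_le_trans t1; rewrite invr_gt0.
apply: le_trans (ler_norm _) _; rewrite normrM ler_wpM2l //.
rewrite ler0_norm ?ln_le0 // -lnV ?posrE // ler_ln ?posrE ?invr_gt0 //.
by rewrite invf_ple ?posrE.
Qed.

(** Near each end point only one factor is singular: [power_bound_half] bounds
the other one there. *)
Lemma cintegrable_beta_kernel z w : 0 < Re z -> 0 < Re w ->
  cintegrable setT (beta_kernel z w).
Proof.
move=> z0 w0.
set x := Re z in z0; set y := Re w in w0.
have i2 := integrable_affine (- 1) ltr01 (integrable_opp (integrable_unit_power w0)).
have := integrableZD (expR (`|y - 1| * ln 2)) (expR (`|x - 1| * ln 2))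
  (integrable_unit_power z0) i2.
apply: cintegrable_dominated => //.
  exact: cmeasurable_beta_kernel.
move=> t _; rewrite /beta_kernel ComplexField.Normc.normcM !normc_power_kernel.
rewrite mul1r opprB -/x -/y.
have [t0|t0] := ltP 0 t; last first.
  rewrite mul0r /= mulr0 add0r mulr_ge0 ?expR_ge0 //.
  by case: ifP => // _; exact: expR_ge0.
have [t1|t1] := ltP 0 (1 - t); last first.
  rewrite mulr0 /= mulr0 addr0 mulr_ge0 ?expR_ge0 //.
  by case: ifP => // _; exact: expR_ge0.
have -> : t <= 1 by lra.
have -> : 1 - t <= 1 by lra.
rewrite /=.
have [h|h] := leP t (2^-1).
  rewrite ler_wpDr ?mulr_ge0 ?expR_ge0 // mulrC ler_wpM2r ?expR_ge0 //.
  by apply: power_bound_half; apply/andP; split; lra.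
rewrite ler_wpDl ?mulr_ge0 ?expR_ge0 // ler_wpM2r ?expR_ge0 //.
by apply: power_bound_half; apply/andP; split; lra.
Qed.

Lemma gamma_integral_kernelE z :
  gamma_integral z = cintegral setT (gamma_kernel z).
Proof.
rewrite /gamma_integral cintegral_mkcond; apply: eq_cintegral => t _.
rewrite mem_setE in_itv /= andbT /gamma_kernel /power_kernel.
case: ifP => t0; last by rewrite mul0r.
by rewrite cpow_gt0 // -cexp_real rmorphN.
Qed.

Lemma gammaE z : 0 < Re z -> gamma z = cintegral setT (gamma_kernel z).
Proof.
move=> z0; rewrite /gamma z0 /pochhammer big_ord0 divr1 addr0.
exact: gamma_integral_kernelE.
Qed.

(** The exponentials combine to [exp (- v)], which does not depend on [s]; the
dilation [s = v s'] then leaves the beta integral. *)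
Lemma gamma_kernel_convolution z w v : 0 < Re z -> 0 < Re w ->
  cintegral setT (fun s => gamma_kernel z s * gamma_kernel w (v - s)) =
  beta_integral z w * gamma_kernel (z + w) v.
Proof.
move=> z0 w0; rewrite /gamma_kernel.
have [v0|v0] := ltP 0 v; last first.
  rewrite [power_kernel (z + w) v]/power_kernel ltNge v0 mul0r mulr0.
  rewrite -[RHS](cintegral0 setT); apply: eq_cintegral => s _.
  rewrite /power_kernel; case: ifP => s0; last by rewrite !mul0r.
  by rewrite [in X in _ * X]ifF ?mul0r ?mulr0 //; apply/negbTE; rewrite -leNgt; lra.
have vV0 : 0 < v^-1 by rewrite invr_gt0.
have ib := cintegrable_beta_kernel z0 w0.
have [_ cZ] := cintegralZ ((expR (- v))%:C * cexp ((z - 1) * (ln v)%:C) *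
  cexp ((w - 1) * (ln v)%:C)) mT (cintegrable_affine 0 vV0 ib).
transitivity ((expR (- v))%:C * cexp ((z - 1) * (ln v)%:C) *
  cexp ((w - 1) * (ln v)%:C) * (v%:C * beta_integral z w)).
  rewrite /beta_integral (cintegral_affine 0 vV0 ib).
  rewrite [X in _ = _ * X]mulrA fmorphV divff ?mul1r; last first.
    by rewrite -normc_gt0 normcR gtr0_norm.
  apply: (etrans _ cZ); apply: eq_cintegral => s _; rewrite addr0 /beta_kernel.
  have e1 : power_kernel z s = cexp ((z - 1) * (ln v)%:C) * power_kernel z (v^-1 * s).
    by rewrite -power_kernelM // mulVKf // gt_eqF.
  have e2 : power_kernel w (v - s) =
      cexp ((w - 1) * (ln v)%:C) * power_kernel w (1 - v^-1 * s).
    by rewrite -power_kernelM // mulrBr mulr1 mulVKf // gt_eqF.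
  have e3 : (expR (- v))%:C = (expR (- s))%:C * (expR (- (v - s)))%:C :> R[i].
    by rewrite -rmorphM -expRD; congr (expR _)%:C; ring.
  by rewrite e1 e2 e3; ring.
rewrite /power_kernel v0.
have -> : v%:C = cexp ((ln v)%:C) :> R[i] by rewrite cexp_real lnK.
have -> : (z + w - 1) * (ln v)%:C =
    (z - 1) * (ln v)%:C + (w - 1) * (ln v)%:C + (ln v)%:C by ring.
by rewrite !cexpD; ring.
Qed.

(** Integrate [gamma_kernel_convolution] over [v]. *)
Lemma gamma_beta z w : 0 < Re z -> 0 < Re w ->
  gamma z * gamma w = beta_integral z w * gamma (z + w).
Proof.
move=> z0 w0; have zw0 : 0 < Re (z + w) by rewrite ReD addr_gt0.
rewrite !gammaE // -cintegral_convolution; try exact: cintegrable_gamma_kernel.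
under eq_cintegral do rewrite gamma_kernel_convolution //.
by have [_ ->] := cintegralZ (beta_integral z w) mT (cintegrable_gamma_kernel zw0).
Qed.

End gamma_function.

(** * The functional equation of Gamma *)

Section gamma_values.
Context {R : realType}.
Implicit Types (z w : R[i]) (t x y : R).
Local Notation muR := (@lebesgue_measure R).

Let mT : measurable [set: measurableTypeR R]. Proof. by []. Qed.

(** Subtracting from [c = B (z, 1)], the integral of [t ^ (z - 1)] over ]0, 1[, the
integral over ]0, 1/2[, which is [2 ^ (- z) c] by dilation, leaves an integral
away from the singularity; it equals [(1 - 2 ^ (- z)) / z]. *)
Lemma beta_integral1 z : 0 < Re z -> beta_integral z 1 = z^-1.
Proof.
move=> z0.
have zn0 : z != 0 by apply: contraTneq z0 => ->; rewrite ltxx.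
set c := beta_integral z 1.
have ib : cintegrable setT (beta_kernel z 1).
  by apply: cintegrable_beta_kernel => //=; exact: ltr01.
have two0 : 0 < (2 : R) by [].
pose q : R[i] := cexp (- (z * (ln (2 : R))%:C)).
have ib2 := cintegrable_affine 0 two0 ib.
have E2 : cintegral setT (fun s => beta_kernel z 1 (2 * s + 0)) = (2^-1)%:C * c.
  rewrite /c /beta_integral (cintegral_affine 0 two0 ib) mulrA -rmorphM.
  by rewrite mulVf ?mul1r.
have [iq Eq] := cintegralZ (- cexp (- ((z - 1) * (ln (2 : R))%:C))) mT ib2.
have [iD ED] := cintegralD mT ib iq.
have [_ EzD] := cintegralZ z mT iD.
have q2 : cexp (- ((z - 1) * (ln (2 : R))%:C)) * (2^-1)%:C = q.
  have -> : (2^-1)%:C = cexp (- (ln (2 : R))%:C) :> R[i].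
    by rewrite -rmorphN cexp_real expRN lnK.
  by rewrite -cexpD; congr cexp; ring.
have q1 : 1 - q != 0.
  rewrite subr_eq0; apply/eqP => /(congr1 (@ComplexField.Normc.normc R)).
  rewrite ComplexField.Normc.normc1 normc_cexp ReN ReM /= mulr0 subr0 => h.
  have : expR (- (Re z * ln 2)) < 1.
    by rewrite expR_lt1 oppr_lt0 mulr_gt0 // ln_gt0 // ltr1n.
  by rewrite -h ltxx.
have : z * ((1 - q) * c) = 1 - q.
  transitivity (z * cintegral setT (fun t => beta_kernel z 1 t +
     - cexp (- ((z - 1) * (ln (2 : R))%:C)) * beta_kernel z 1 (2 * t + 0))).
    by rewrite ED Eq E2 mulrA mulNr q2 -/c mulrBl mul1r mulNr.
  rewrite -EzD.
  transitivity (cintegral `[2^-1, (1 : R)[ (fun t => z * cexp ((z - 1) * (ln t)%:C))).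
    rewrite [RHS]cintegral_mkcond; apply: eq_cintegral => t _.
    rewrite mem_setE in_itv /= addr0 /beta_kernel power_kernelM // !mulNr mulrA mulrA.
    rewrite -cexpD addNr cexp0 mul1r -mulrBr /power_kernel.
    rewrite subrr mul0r cexp0.
    have half : (0 < 1 - 2 * t) = (t < 2^-1).
      by rewrite subr_gt0 -ltr_pdivlMl // mulr1.
    rewrite half subr_gt0.
    have [t0|t0] := ltP 0 t; last first.
      have -> : (2^-1 <= t) = false by apply/negbTE; rewrite -ltNge; lra.
      by rewrite /= mul0r mulr0.
    have [h1|h1] := ltP t 1; have [h2|h2] := leP 2^-1 t; rewrite /=.

    - by rewrite subr0 mulr1.
    - by rewrite ?mul0r ?cexp0 subrr !mulr0.
    - by rewrite ?mul0r ?cexp0 subrr !mulr0.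
    - by exfalso; lra.
  have E : cintegral `[2^-1, (1 : R)[ (fun t => z * cexp ((z - 1) * (ln t)%:C)) =
     cintegral `[2^-1, (1 : R)] (fun t => z * cexp ((z - 1) * (ln t)%:C)).
    have m : cmeasurable setT (fun t => z * cexp ((z - 1) * (ln t)%:C)).
      apply: cmeasurableM; first exact: cmeasurable_cst.
      apply: cmeasurable_cexp; apply: cmeasurableM; first exact: cmeasurable_cst.
      by apply: cmeasurable_real; exact: measurable_ln.
    case: m => m1 m2.
    congr (fine _ +i* fine _); apply: integral_itv_bndo_bndc; apply/measurable_EFinP.
      exact: measurable_funTS m1.
    exact: measurable_funTS m2.
  rewrite E cintegral_power; last by apply/andP; split; lra.
  rewrite ln1 mulr0 cexp0 lnV ?posrE // rmorphN mulrN -/q.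
  by [].
rewrite mulrCA => /(canRL (mulKf q1)); rewrite mulVf // => zc.
by rewrite -[RHS]mulr1 -zc mulKf.
Qed.

Lemma gamma1 : gamma (1 : R[i]) = 1.
Proof.
rewrite /gamma /= ltr01 /pochhammer big_ord0 divr1 addr0 /gamma_integral.
have -> : cintegral `]0, +oo[ (fun t => cpow t%:C (1 - 1) * cexp (- t%:C)) =
    cintegral `]0, +oo[ (fun t => (expR (- t))%:C) :> R[i].
  apply: eq_cintegral => t; rewrite mem_setE in_itv /= andbT => t0.
  by rewrite cpow_gt0 // subrr mul0r cexp0 mul1r -rmorphN cexp_real.
apply: complex_ext; rewrite ?cintegral_ReE ?cintegral_ImE /=; last first.
  by rewrite /Rintegral integral0.
have -> : \int[mu]_(t in `]0, +oo[) expR (- t) = \int[mu]_(t in `[0, +oo[) expR (- t) :> R.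
  congr fine; apply: integral_itv_obnd_cbnd; apply/measurable_EFinP.
  apply: measurableT_comp (@measurable_expR R) _.
  exact: oppr_measurable.
rewrite Rintegral_mkcond.
have := @integral_exponential_pdf R 1 ltr01.
rewrite /Rintegral => h.
rewrite (_ : (\int[mu]_t ((fun t0 => expR (- t0)) \_ `[0, +oo[ t)%:E)%E = 1%E) //.
rewrite -h; apply: eq_integral => t _; congr EFin.
by rewrite /exponential_pdf !patchE; case: ifP => // _; rewrite mul1r mulN1r.
Qed.

(** The beta identity at [w = 1]. *)
Lemma gammaS z : 0 < Re z -> gamma (z + 1) = z * gamma z.
Proof.
move=> z0.
have zn0 : z != 0 by apply: contraTneq z0 => ->; rewrite ltxx.
have := @gamma_beta R z 1 z0 ltr01.
by rewrite gamma1 mulr1 beta_integral1 // => ->; rewrite mulVKf.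
Qed.

Lemma pochhammerS z n : pochhammer z n.+1 = pochhammer z n * (z + n%:R).
Proof. by rewrite /pochhammer big_ord_recr. Qed.

Lemma pochhammer0 z : pochhammer z 0 = 1.
Proof. by rewrite /pochhammer big_ord0. Qed.

Lemma gammaDn z n : 0 < Re z -> gamma (z + n%:R) = pochhammer z n * gamma z.
Proof.
move=> z0; elim: n => [|n IH]; first by rewrite addr0 pochhammer0 mul1r.
rewrite -natr1 addrA gammaS ?ReDn ?ltr_wpDr //.
by rewrite IH pochhammerS mulrA; congr (_ * _); rewrite mulrC.
Qed.

Lemma pochhammer1 n : pochhammer (1 : R[i]) n = n`!%:R.
Proof.
elim: n => [|n IH]; first by rewrite pochhammer0.
by rewrite pochhammerS IH factS mulnC natrM -natr1 addrC.
Qed.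

Lemma pochhammerD z m n :
  pochhammer z (m + n) = pochhammer z m * pochhammer (z + m%:R) n.
Proof.
elim: n => [|n IH]; first by rewrite addn0 pochhammer0 mulr1.
by rewrite addnS !pochhammerS IH natrD addrA mulrA.
Qed.

Lemma pochhammer_neq0 z n : 0 < Re z -> pochhammer z n != 0.
Proof.
move=> z0; apply/prodf_neq0 => i _.
have : 0 < Re (z + (i : nat)%:R) by rewrite ReDn ltr_wpDr.
by apply: contraTneq => ->; rewrite ltxx.
Qed.

End gamma_values.

(** * Gamma has no zero in the right half-plane *)

Section gamma_nonvanishing.
Context {R : realType}.
Implicit Types (z w : R[i]) (t x y s : R).
Local Notation muR := (@lebesgue_measure R).

Let mT : measurable [set: measurableTypeR R]. Proof. by []. Qed.

Definition real_gamma s : R := Re (gamma s%:C).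

Definition real_gamma_kernel s t : R :=
  if 0 < t then expR ((s - 1) * ln t) * expR (- t) else 0.

Lemma gamma_kernel_real s t : gamma_kernel s%:C t = (real_gamma_kernel s t)%:C.
Proof.
rewrite /gamma_kernel /power_kernel /real_gamma_kernel.
case: ifP => _; last by rewrite mul0r.
by rewrite -[1 : R[i]]/(1%:C) -rmorphB -rmorphM cexp_real -rmorphM.
Qed.

Lemma integrable_real_gamma_kernel s : 0 < s ->
  muR.-integrable setT (EFin \o real_gamma_kernel s).
Proof.
move=> s0; have [h _] := @cintegrable_gamma_kernel R s%:C s0.
by apply: eq_integrable h => // t _; rewrite gamma_kernel_real.
Qed.

Lemma real_gammaE s : 0 < s ->
  real_gamma s = \int[mu]_t real_gamma_kernel s t.
Proof.
move=> s0; rewrite /real_gamma gammaE // cintegral_ReE.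
by apply: eq_Rintegral => t _; rewrite gamma_kernel_real.
Qed.

Lemma gamma_real s : 0 < s -> gamma s%:C = (real_gamma s)%:C.
Proof.
move=> s0; apply: complex_ext => //; rewrite gammaE // cintegral_ImE.
rewrite /Rintegral integral0_eq // => t _.
by rewrite gamma_kernel_real.
Qed.

Lemma real_gammaS s : 0 < s -> real_gamma (s + 1) = s * real_gamma s.
Proof.
move=> s0; rewrite /real_gamma rmorphD gammaS // gamma_real // -rmorphM.
by [].
Qed.

Lemma real_gamma1 : real_gamma 1 = 1.
Proof. by rewrite /real_gamma gamma1. Qed.

(** Keep only the part of Euler's integral over [t >= M], where
[t ^ (s - 1) >= M ^ (s - 1)].  As [M] is free, this is faster than geometric
growth in [s]. *)
Lemma real_gamma_ge s (M : R) : 1 <= s -> 0 < M ->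
  expR ((s - 1) * ln M) * expR (- M) <= real_gamma s.
Proof.
move=> s1 M0.
have s0 : 0 < s by exact: lt_le_trans s1.
have i1 := integrable_real_gamma_kernel (@ltr01 R).
have is_ := integrable_real_gamma_kernel s0.
have iM := integrable_affine M ltr01 is_.
set C := leLHS; rewrite -[C]mulr1 -real_gamma1 !real_gammaE // -RintegralZl //.
rewrite (Rintegral_affine M ltr01 is_) mul1r.
apply: le_Rintegral => //.
  rewrite (_ : EFin \o _ = (fun t => C%:E * (real_gamma_kernel 1 t)%:E)%E); first exact: integrableZl.
  by apply/funext => t /=; rewrite EFinM.
move=> t _; rewrite /C /real_gamma_kernel mul1r subrr mul0r expR0 mul1r.
have [t0|t0] := ltP 0 t; last first.
  by rewrite mulr0; case: ifP => // _; rewrite mulr_ge0 ?expR_ge0.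
have tM : 0 < t + M by rewrite addr_gt0.
rewrite tM -mulrA -expRD -opprD [M + t]addrC ler_wpM2r ?expR_ge0 //.
rewrite ler_expR ler_wpM2l ?subr_ge0 // ler_ln ?posrE //.
by rewrite lerDr ltW.
Qed.

Lemma real_gamma_gt0 s : 1 <= s -> 0 < real_gamma s.
Proof.
move=> s1; apply: lt_le_trans (real_gamma_ge s1 ltr01).
by rewrite mulr_gt0 // expR_gt0.
Qed.

Lemma sin_le_id x : 0 <= x -> `|sin x| <= x.
Proof.
rewrite le_eqVlt => /predU1P[<-|x0]; first by rewrite sin0 normr0.
have [|c _] := @MVT R sin cos 0 x x0 (fun u _ => is_derive_sin u).
  by apply: continuous_subspaceT => u; exact: continuous_sin.
rewrite sin0 !subr0 => ->; rewrite normrM (gtr0_norm x0).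
by apply: ler_piMl; [exact: ltW|exact: cos_max].
Qed.

Lemma cos_ge_quadratic x : 1 - x ^+ 2 / 2 <= cos x.
Proof.
have -> : cos x = 1 - 2 * sin (x / 2) ^+ 2.
  rewrite [X in cos X](_ : x = (x / 2) *+ 2); last by rewrite mulr2n -splitr.
  by rewrite cos_mulr2n cos2sin2; ring.
have h : sin (x / 2) ^+ 2 <= (x / 2) ^+ 2.
  rewrite -(real_normK (num_real (sin (x / 2)))) -(real_normK (num_real (x / 2))).
  rewrite ler_sqr ?nnegrE //.
  have [x0|x0] := leP 0 x.
    by rewrite (@ger0_norm _ (x / 2)) ?divr_ge0 // sin_le_id // divr_ge0.
  rewrite -normrN -sinN (@ltr0_norm _ (x / 2)); last by rewrite pmulr_llt0 // invr_gt0.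
  by rewrite sin_le_id // oppr_ge0 pmulr_lle0 ?ltW // invr_gt0.
have -> : x ^+ 2 / 2 = 2 * (x / 2) ^+ 2 by field.
by rewrite lerB // ler_wpM2l.
Qed.

(** The right-hand side is [4 (exp (x / 2) - exp (- x / 2)) ^ 2], and
[exp (x / 2) - exp (- x / 2) >= x / 2] for [x >= 0].  Applied to [x = ln (t / s)], it
replaces the logarithm by [t / s + s / t - 2], whose integral against the gamma
kernel is explicit. *)
Lemma sqr_le_expR x : x ^+ 2 <= 4 * (expR x + expR (- x) - 2).
Proof.
wlog x0 : x / 0 <= x => [h|].
  have [/h//|/ltW x0] := leP 0 x.
  by rewrite -sqrrN (le_trans (h (- x) _)) ?oppr_ge0 // opprK [expR (- x) + _]addrC.
set a := expR (x / 2); set b := expR (- (x / 2)).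
have -> : expR x + expR (- x) - 2 = (a - b) ^+ 2.
  have ea : expR x = a ^+ 2 by rewrite /a -expRM_natl mulrC divfK.
  have eb : expR (- x) = b ^+ 2 by rewrite /b -expRM_natl mulrN mulrC divfK.
  have ab : a * b = 1 by rewrite /a /b -expRD subrr expR0.
  by rewrite ea eb sqrrB -ab; ring.
have -> : x ^+ 2 = 4 * (x / 2) ^+ 2 by field.
rewrite ler_wpM2l // ler_sqr ?nnegrE ?divr_ge0 //.
  have h1 := expR_ge1Dx (x / 2).
  have h2 : b <= 1 by rewrite expR_le1 oppr_le0 divr_ge0.
  by rewrite -/a in h1; lra.
by rewrite subr_ge0 ler_expR; lra.
Qed.

(** For [s] large, the mass of [t ^ (s - 1) exp (- t)] sits so close to [t = s]
that the oscillating factor [t ^ (i y)] cannot cancel.  After multiplication by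
[s ^ (- i y)], the real part of the integrand is the kernel times
[cos (y ln (t / s)) >= 1 - 2 y ^ 2 (t / s + s / t - 2)]; the three terms are gamma
kernels at [s], [s + 1] and [s - 1], and the functional equation sums them to
[real_gamma s (1 - 2 y ^ 2 / (s - 1))]. *)
Lemma gamma_neq0_large s y : 1 < s -> 2 * y ^+ 2 < s - 1 ->
  gamma (s +i* y) != 0.
Proof.
move=> s1 ys.
have s0 : 0 < s by exact: lt_trans s1.
set z := s +i* y; have z0 : 0 < Re z by [].
pose c : R[i] := cexp (- ((0 +i* y) * (ln s)%:C)).
have iz := cintegrable_gamma_kernel z0.
have [iZ cZ] := cintegralZ c mT iz.
suff : 0 < Re (c * gamma z).
  by apply: contraTneq => ->; rewrite mulr0 ltxx.
rewrite gammaE // -cZ cintegral_ReE.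
(* The minorant of the real part; expand [1 - 2 y^2 (t / s + s / t - 2)]. *)
pose k t := (1 + 4 * y ^+ 2) * real_gamma_kernel s t
  - (2 * y ^+ 2 / s) * real_gamma_kernel (s + 1) t
  - (2 * y ^+ 2 * s) * real_gamma_kernel (s - 1) t.
have sm : 0 < s - 1 by rewrite subr_gt0.
have sp : 0 < s + 1 by rewrite addr_gt0.
have i1 := integrable_real_gamma_kernel s0.
have i2 := integrable_real_gamma_kernel sp.
have i3 := integrable_real_gamma_kernel sm.
have iZr (a x : R) : 0 < x -> muR.-integrable setT (fun t => (a * real_gamma_kernel x t)%:E).
  move=> x0; rewrite (_ : (fun t => _) = (fun t => a%:E * (real_gamma_kernel x t)%:E)%E).
    by apply: integrableZl => //; exact: integrable_real_gamma_kernel.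
  by apply/funext => t; rewrite EFinM.
have i12 : muR.-integrable setT (fun t => ((1 + 4 * y ^+ 2) * real_gamma_kernel s t
  - (2 * y ^+ 2 / s) * real_gamma_kernel (s + 1) t)%:E).
  rewrite (_ : (fun t => _) = (fun t => ((1 + 4 * y ^+ 2) * real_gamma_kernel s t)%:E)
    \- (fun t => ((2 * y ^+ 2 / s) * real_gamma_kernel (s + 1) t)%:E))%E.
    by apply: integrableB => //; exact: iZr.
  by apply/funext => t; rewrite EFinB.
have ik : muR.-integrable setT (fun t => (k t)%:E).
  rewrite (_ : (fun t => _) = (fun t => ((1 + 4 * y ^+ 2) * real_gamma_kernel s t
  - (2 * y ^+ 2 / s) * real_gamma_kernel (s + 1) t)%:E)
    \- (fun t => ((2 * y ^+ 2 * s) * real_gamma_kernel (s - 1) t)%:E))%E.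
    by apply: integrableB => //; exact: iZr.
  by apply/funext => t; rewrite EFinB.
have Ik : \int[mu]_t k t = real_gamma s * (1 - 2 * y ^+ 2 / (s - 1)).
  rewrite /k RintegralB //; last exact: iZr.
  rewrite RintegralB //; [|exact: iZr|exact: iZr].
  rewrite !RintegralZl // -!real_gammaE // real_gammaS //.
  have := real_gammaS sm; rewrite subrK => e.
  rewrite e; field; apply/andP; split; lra.
apply: (@lt_le_trans _ _ (\int[mu]_t k t)).
  rewrite Ik mulr_gt0 ?real_gamma_gt0 ?ltW // subr_gt0 ltr_pdivrMr // mul1r.
  exact: ys.
apply: le_Rintegral => //; first by case: iZ.
move=> t _; rewrite /k /real_gamma_kernel /gamma_kernel /power_kernel.
have [t0|t0] := ltP 0 t; last by rewrite !mulr0 !subr0 mul0r mulr0.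
rewrite [X in _ <= Re X]mulrA /c -cexpD ReMr Re_cexp.
have -> : Re (- ((0 +i* y) * (ln s)%:C) + (z - 1) * (ln t)%:C) = (s - 1) * ln t.
  by rewrite ReD ReN !ReM /=; ring.
have -> : Im (- ((0 +i* y) * (ln s)%:C) + (z - 1) * (ln t)%:C) = y * ln (t / s).
  by rewrite ImD ImN !ImM /= ln_div ?posrE //; ring.
set e := expR ((s - 1) * ln t).
have -> : expR ((s + 1 - 1) * ln t) = e * t.
  by rewrite -{2}(lnK (_ : t \is Num.pos)) ?posrE // -expRD; congr expR; ring.
have -> : expR ((s - 1 - 1) * ln t) = e / t.
  by rewrite -{2}(lnK (_ : t \is Num.pos)) ?posrE // -expRB; congr expR; ring.
have q1 := cos_ge_quadratic (y * ln (t / s)).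
have q2 := sqr_le_expR (ln (t / s)).
rewrite -lnV ?posrE ?divr_gt0 // !lnK ?posrE ?invr_gt0 ?divr_gt0 // invf_div in q2.
have q3 : 1 - 2 * y ^+ 2 * (t / s + s / t - 2) <= cos (y * ln (t / s)).
  apply: le_trans q1; rewrite lerD2l lerN2 exprMn.
  have := ler_wpM2l (sqr_ge0 y) q2; lra.
have -> : (1 + 4 * y ^+ 2) * (e * expR (- t)) - 2 * y ^+ 2 / s * (e * t * expR (- t)) -
    2 * y ^+ 2 * s * (e / t * expR (- t)) =
  e * (1 - 2 * y ^+ 2 * (t / s + s / t - 2)) * expR (- t).
  by field; rewrite !gt_eqF.
by rewrite ler_wpM2r ?expR_ge0 // ler_wpM2l ?expR_ge0.
Qed.

(** A zero at [z] would propagate to all [z + n], contradicting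
[gamma_neq0_large]. *)
Lemma gamma_neq0 z : 0 < Re z -> gamma z != 0.
Proof.
case: z => s y s0; set z := s +i* y.
pose n := (Num.truncn (2 * y ^+ 2 + 1)).+1.
have hn : 2 * y ^+ 2 + 1 < n%:R by exact: truncnS_gt.
have : gamma (z + n%:R) != 0.
  have -> : z + n%:R = (s + n%:R) +i* y.
    by rewrite natC /z; apply: complex_ext; rewrite /= ?addr0.
  have y2 : 0 <= y ^+ 2 by exact: sqr_ge0.
  by rewrite /= in s0; apply: gamma_neq0_large; lra.
by rewrite gammaDn // mulf_eq0 negb_or => /andP[].
Qed.

End gamma_nonvanishing.

(** * The binomial series *)

Section binomial_series.
Context {R : realType}.
Implicit Types (a z w x : R[i]) (t r : R).

Definition binomial_coef a n : R[i] := pochhammer a n / n`!%:R.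

Lemma fact_neq0C n : (n`!%:R : R[i]) != 0.
Proof. by rewrite pnatr_eq0 -lt0n fact_gt0. Qed.

Lemma binomial_coef0 a : binomial_coef a 0 = 1.
Proof. by rewrite /binomial_coef pochhammer0 divr1. Qed.

Lemma binomial_coefS a n :
  binomial_coef a n.+1 = binomial_coef a n * ((a + n%:R) / n.+1%:R).
Proof.
rewrite /binomial_coef pochhammerS factS natrM invfM.
by rewrite [X in _ * X]mulrC mulrACA.
Qed.

Lemma pochhammerSl a n : pochhammer a n.+1 = a * pochhammer (a + 1) n.
Proof.
have := pochhammerD a 1 n; rewrite add1n => ->.
by rewrite pochhammerS pochhammer0 mul1r addr0.
Qed.

(** Differentiating the series of exponent [a] term by term gives, up to the
factor [a x], the series of exponent [a + 1]; so one convergence result covers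
all its derivatives. *)
Lemma binomial_coef_diff a n :
  n.+1%:R * binomial_coef a n.+1 = a * binomial_coef (a + 1) n.
Proof.
rewrite /binomial_coef pochhammerSl factS natrM invfM mulrCA.
by rewrite [X in _ * X]mulrA divff ?pnatr_eq0 // mul1r mulrA.
Qed.

Lemma binomial_coef_pascal a n :
  binomial_coef (a + 1) n.+1 = binomial_coef a n.+1 + binomial_coef (a + 1) n.
Proof.
have nz : (n.+1%:R : R[i]) != 0 by rewrite pnatr_eq0.
apply: (mulfI nz); rewrite mulrDr [X in _ = X + _]binomial_coef_diff.
rewrite binomial_coefS mulrCA [X in _ * X]mulrC divfK //.
by rewrite -mulrDl mulrC -addrA [1 + _]addrC natr1.
Qed.

(** The factor from one term to the next tends to [r] in norm, so it is at most
[q = (r + 1) / 2] from some rank [N] on; [C] takes care of the first terms. *)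
Lemma binomial_coef_geometric a r : 0 <= r < 1 ->
  exists C q, [/\ 0 <= C, 0 < q < 1 &
    forall n, normc (binomial_coef a n) * r ^+ n <= C * q ^+ n].
Proof.
move=> /andP[r0 r1].
pose q := (r + 1) / 2; pose d n := normc (binomial_coef a n) * r ^+ n.
have q0 : 0 < q by rewrite /q; lra.
have q1 : q < 1 by rewrite /q; lra.
have rq : 0 < q - r by rewrite /q; lra.
have d0 n : 0 <= d n by rewrite mulr_ge0 ?normc_ge0 ?exprn_ge0.
(* From [N] on, [(|a| + n) r <= q (n + 1)]. *)
pose N := (Num.truncn (normc a * r / (q - r))).+1.
have step n : (N <= n)%N -> d n.+1 <= d n * q.
  move=> Nn.
  have h : normc a * r / (q - r) < n%:R.
    by apply: lt_le_trans (truncnS_gt _) _; rewrite ler_nat.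
  rewrite ltr_pdivrMr // in h.
  rewrite /d binomial_coefS ComplexField.Normc.normcM exprSr mulrACA.
  rewrite ler_wpM2l ?d0 //.
  rewrite ComplexField.Normc.normcM ComplexField.Normc.normcV normc_nat.
  have := normcD a n%:R; rewrite normc_nat => h1.
  rewrite mulrAC ler_pdivrMr // -natr1.
  apply: le_trans (ler_wpM2r r0 h1) _; nra.
pose C := \sum_(0 <= i < N.+1) d i / q ^+ i.
have C0 : 0 <= C by apply: sumr_ge0 => i _; rewrite divr_ge0 ?exprn_ge0 ?(ltW q0).
exists C, q; split => //; first by rewrite q0.
have small n : (n <= N)%N -> d n <= C * q ^+ n.
  move=> nN; rewrite -ler_pdivrMr ?exprn_gt0 // /C.
  rewrite (big_cat_nat (n := n)) //=; last by rewrite leqW.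
  rewrite [X in _ + X]big_ltn ?ltnS // addrCA lerDl.
  by rewrite addr_ge0 // sumr_ge0 // => i _; rewrite divr_ge0 ?exprn_ge0 ?(ltW q0).
elim=> [|n IH]; first exact: (small 0%N).
have [nN|Nn] := leqP n.+1 N; first exact: small.
apply: le_trans (step n Nn) _; rewrite exprSr mulrA.
by rewrite ler_wpM2r // ltW.
Qed.

Lemma cseries_geometric (u : nat -> R[i]) (C q : R) : 0 < q < 1 ->
  (forall n, normc (u n) <= C * q ^+ n) -> cseries_cvg u.
Proof.
move=> /andP[q0 q1] uC; apply: cseries_dominated uC _.
by apply: (@is_cvg_geometric_series _ C q); rewrite gtr0_norm.
Qed.

Lemma cvg_binomial_series a z : normc z < 1 ->
  cseries_cvg (fun n => binomial_coef a n * z ^+ n).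
Proof.
move=> z1.
have [|C [q [_ q01 h]]] := @binomial_coef_geometric a (normc z).
  by rewrite normc_ge0.
apply: cseries_geometric q01 _ => n.
by rewrite ComplexField.Normc.normcM normcX; exact: h.
Qed.

Definition binomial_sum a z : R[i] := cseries (fun n => binomial_coef a n * z ^+ n).

(** Pascal's rule makes the partial sums telescope up to one term that tends
to 0.  With [binomial_coef_diff] it is the differential equation
[(1 - x t) f' = a x f]. *)
Lemma binomial_sum_shift a z : normc z < 1 ->
  (1 - z) * binomial_sum (a + 1) z = binomial_sum a z.
Proof.
move=> z1.
have c1 := @cvg_binomial_series (a + 1) z z1.
have c0 := @cvg_binomial_series a z z1.
pose S b n := series (fun n => binomial_coef b n * z ^+ n : R[i]^o) n.
have rec n : (1 - z) * S (a + 1) n.+1 = S a n.+1 - z * (binomial_coef (a + 1) n * z ^+ n).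
  elim: n => [|n IH].
    by rewrite /S /series /= !big_nat1 !binomial_coef0 !expr0 !mulr1.
  have SS b m : S b m.+1 = S b m + binomial_coef b m * z ^+ m.
    by rewrite /S /series /= big_nat_recr.
  rewrite SS mulrDr IH SS [S a n.+2]SS [S a n.+1]SS binomial_coef_pascal !exprS; ring.
have lim1 : ((fun n => (1 - z) * S (a + 1) n.+1) : nat -> R[i]^o) @ \oo -->
    ((1 - z) * binomial_sum (a + 1) z : R[i]^o).
  apply: ccvgM; first exact: cvg_cst.
  exact: ccvg_shiftS c1.
have lim2 : ((fun n => S a n.+1 - z * (binomial_coef (a + 1) n * z ^+ n))
    : nat -> R[i]^o) @ \oo --> (binomial_sum a z - z * 0 : R[i]^o).
  apply: ccvgB; first exact: ccvg_shiftS c0.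
  apply: ccvgM; first exact: cvg_cst.
  exact: (cvg_series_cvg_0 c1).
have e : (fun n => (1 - z) * S (a + 1) n.+1) =
    (fun n => S a n.+1 - z * (binomial_coef (a + 1) n * z ^+ n)).
  by apply/funext.
by rewrite e in lim1; rewrite (ccvg_unique _ lim1 lim2) mulr0 subr0.
Qed.

End binomial_series.

(** * Differentiating the binomial series along a ray *)

Section binomial_theorem.
Context {R : realType}.
Implicit Types (a z w x : R[i]) (t r : R).

(** Evaluated componentwise, since termwise differentiation is available for
real power series; it agrees with [cseries] inside the disk of convergence
([cpseriesE]). *)
Definition cpseries (u : nat -> R[i]) t : R[i] :=
  limn (pseries (fun n => Re (u n)) t) +i* limn (pseries (fun n => Im (u n)) t).

Lemma is_cvg_pseries_dominated (p : R[i] -> R) (u : nat -> R[i]) (C q K t : R) :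
  (forall z, `|p z| <= normc z) -> 0 < q < 1 -> `|t| <= K ->
  (forall n, normc (u n) * K ^+ n <= C * q ^+ n) ->
  cvgn (pseries (fun n => p (u n)) t).
Proof.
move=> pn /andP[q0 q1] tK uC; apply: normed_cvg.
apply: (@series_le_cvg _ _ (geometric C q)) => [n|n|n|].
- exact: normr_ge0.
- apply: le_trans (uC n); rewrite mulr_ge0 ?normc_ge0 // exprn_ge0 //.
  exact: le_trans tK.
- apply: le_trans (uC n); rewrite /= normrM normrX ler_pM ?exprn_ge0 //.
  by rewrite lerXn2r // nnegrE (le_trans _ tK).
- by apply: is_cvg_geometric_series; rewrite gtr0_norm.
Qed.

Lemma cpseriesE (u : nat -> R[i]) (C q K t : R) : 0 < q < 1 -> `|t| <= K ->
  (forall n, normc (u n) * K ^+ n <= C * q ^+ n) ->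
  cpseries u t = cseries (fun n => u n * t%:C ^+ n).
Proof.
move=> q01 tK uC.
have c1 := is_cvg_pseries_dominated (@Re_le_normc R) q01 tK uC.
have c2 := is_cvg_pseries_dominated (@Im_le_normc R) q01 tK uC.
apply/esym; apply: (cseriesP _).2; apply/ccvg_seriesP; split.
  rewrite [X in series X](_ : _ = (fun n => Re (u n) * t ^+ n)) //.
  by apply/funext => n /=; rewrite -rmorphXn ReMr.
rewrite [X in series X](_ : _ = (fun n => Im (u n) * t ^+ n)) //.
by apply/funext => n /=; rewrite -rmorphXn ImM /= mulr0 add0r.
Qed.

(** The three sequences in the hypothesis are the coefficients of the series and
of its first two derivatives. *)
Lemma is_cderive_cpseries (u : nat -> R[i]) (K t : R) :
  (forall (p : R[i] -> R) v, (forall z, `|p z| <= normc z) ->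
    (v = u \/ v = (fun n => n.+1%:R * u n.+1) \/
     v = (fun n => n.+1%:R * (n.+2%:R * u n.+2))) ->
    cvgn (pseries (fun n => p (v n)) K)) ->
  `|t| < `|K| ->
  is_cderive (cpseries u) t (cpseries (fun n => n.+1%:R * u n.+1) t).
Proof.
move=> cv tK.
have ReZ n z : Re (n%:R * z) = n%:R * Re z by rewrite natC mulrC ReMr mulrC.
have ImZ n z : Im (n%:R * z) = n%:R * Im z by rewrite natC ImM /= mul0r addr0.
split.
  have := @pseries_snd_diffs R (fun n => Re (u n)) K t.
  have e1 : pseries_diffs (fun n => Re (u n)) = (fun n => Re (n.+1%:R * u n.+1)).
    by apply/funext => n; rewrite ReZ.
  rewrite !e1 => H; apply: H tK.
  - by apply: cv; [exact: Re_le_normc|left].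
  - by apply: (cv (@complex.Re R) (fun n => n.+1%:R * u n.+1)); [exact: Re_le_normc|right; left].
  - rewrite (_ : pseries_diffs _ = (fun n => Re (n.+1%:R * (n.+2%:R * u n.+2)))).
      by apply: (cv (@complex.Re R) (fun n => n.+1%:R * (n.+2%:R * u n.+2))); [exact: Re_le_normc|right; right].
    by apply/funext => n; rewrite /pseries_diffs -ReZ.
have := @pseries_snd_diffs R (fun n => Im (u n)) K t.
have e1 : pseries_diffs (fun n => Im (u n)) = (fun n => Im (n.+1%:R * u n.+1)).
  by apply/funext => n; rewrite ImZ.
rewrite !e1 => H; apply: H tK.
- by apply: cv; [exact: Im_le_normc|left].
- by apply: (cv (@complex.Im R) (fun n => n.+1%:R * u n.+1)); [exact: Im_le_normc|right; left].
- rewrite (_ : pseries_diffs _ = (fun n => Im (n.+1%:R * (n.+2%:R * u n.+2)))).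
    by apply: (cv (@complex.Im R) (fun n => n.+1%:R * (n.+2%:R * u n.+2))); [exact: Im_le_normc|right; right].
  by apply/funext => n; rewrite /pseries_diffs -ImZ.
Qed.

(** The radius [2 / (1 + |x|)] exceeds 1, and [2 |x| / (1 + |x|) < 1]: the series in
[t] still converges a little beyond [t = 1], so that it can be differentiated on
the closed unit interval. *)
Lemma binomial_ray_geometric a x : normc x < 1 ->
  exists C q, 0 < q < 1 /\
    forall n, normc (binomial_coef a n * x ^+ n) * (2 / (1 + normc x)) ^+ n <= C * q ^+ n.
Proof.
move=> x1; have x0 := normc_ge0 x.
set K := 2 / (1 + normc x).
have K0 : 0 < K by rewrite divr_gt0 // ltr_wpDr.
have [|C [q [_ q01 h]]] := @binomial_coef_geometric R a (normc x * K).
  rewrite mulr_ge0 ?(ltW K0) //= /K mulrA ltr_pdivrMr ?ltr_wpDr //.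
  by rewrite mul1r; lra.
exists C, q; split => // n.
by rewrite ComplexField.Normc.normcM normcX -mulrA -exprMn.
Qed.

Definition binomial_ray a x t : R[i] := cpseries (fun n => binomial_coef a n * x ^+ n) t.

Lemma ray_radius x t : normc x < 1 -> `|t| <= 1 -> `|t| < 2 / (1 + normc x).
Proof.
move=> x1 t1; have x0 := normc_ge0 x.
have d : 0 < 1 + normc x by lra.
by rewrite (le_lt_trans t1) // ltr_pdivlMr // mul1r; lra.
Qed.

Lemma binomial_rayE a x t : normc x < 1 -> `|t| <= 1 ->
  binomial_ray a x t = binomial_sum a (x * t%:C).
Proof.
move=> x1 t1; have [C [q [q01 h]]] := binomial_ray_geometric a x1.
rewrite /binomial_ray (cpseriesE q01 (ltW (ray_radius x1 t1)) h).
by congr cseries; apply/funext => n; rewrite exprMn mulrA.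
Qed.

Lemma is_cderive_binomial_ray a x t : normc x < 1 -> `|t| <= 1 ->
  is_cderive (binomial_ray a x) t (a * x * binomial_sum (a + 1) (x * t%:C)).
Proof.
move=> x1 t1.
pose u b n : R[i] := binomial_coef b n * x ^+ n.
have uS b n : n.+1%:R * u b n.+1 = b * x * u (b + 1) n.
  by rewrite /u mulrA binomial_coef_diff exprS; ring.
have dom b c : exists C q, 0 < q < 1 /\
    forall n, normc (c * u b n) * (2 / (1 + normc x)) ^+ n <= C * q ^+ n.
  have [C [q [q01 h]]] := binomial_ray_geometric b x1.
  exists (normc c * C), q; split => // n.
  rewrite (ComplexField.Normc.normcM c (u b n)) -2!mulrA.
  by apply: ler_wpM2l; [exact: normc_ge0|exact: h].
have tK := ray_radius x1 t1.
have K0 : 0 < 2 / (1 + normc x) by exact: le_lt_trans tK.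
have e1 : (fun n => n.+1%:R * u a n.+1) = (fun n => a * x * u (a + 1) n).
  by apply/funext => n; exact: uS.
have e2 : (fun n => n.+1%:R * (n.+2%:R * u a n.+2)) =
    (fun n => a * x * ((a + 1) * x) * u (a + 1 + 1) n).
  by apply/funext => n; rewrite uS mulrCA uS; ring.
have [C [q [q01 h]]] := dom (a + 1) (a * x).
have -> : a * x * binomial_sum (a + 1) (x * t%:C) =
    cpseries (fun n => n.+1%:R * u a n.+1) t.
  rewrite e1 (cpseriesE q01 (ltW tK) h).
  have [|_ <-] := @cseriesZ R (a * x) (fun n => binomial_coef (a + 1) n * (x * t%:C) ^+ n).
    apply: cvg_binomial_series; rewrite ComplexField.Normc.normcM normcR.
    by apply: le_lt_trans x1; rewrite ler_piMr ?normc_ge0.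
  by congr cseries; apply/funext => n; rewrite /u exprMn; ring.
apply: (@is_cderive_cpseries (u a) (2 / (1 + normc x)) t).
  move=> p v pn.
  have c1 (v1 : nat -> R[i]) b c : v1 = (fun n => c * u b n) -> cvgn (pseries (fun n => p (v1 n)) (2 / (1 + normc x))).
    move=> ->; have [C' [q' [q01' h']]] := dom b c.
    by apply: (is_cvg_pseries_dominated pn q01' _ h'); rewrite gtr0_norm.
  move=> [->|[->|->]].
  - by apply: (c1 _ a 1); apply/funext => n; rewrite mul1r.
  - exact: (c1 _ _ _ e1).
  - exact: (c1 _ _ _ e2).
by rewrite (gtr0_norm K0).
Qed.

End binomial_theorem.

(** * Principal powers in the right half-plane *)

Section principal_power.
Context {R : realType}.
Implicit Types (a z w x : R[i]) (t r : R).

(** The principal logarithm on the right half-plane, in a form that is easy to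
differentiate. *)
Definition log_atan w : R[i] :=
  (2^-1 * ln (Re w ^+ 2 + Im w ^+ 2)) +i* atan (Im w / Re w).

Lemma clogE w : 0 < Re w -> clog w = log_atan w.
Proof.
move=> w0; set m := Re w ^+ 2 + Im w ^+ 2.
have m0 : 0 < m by rewrite ltr_wpDr ?sqr_ge0 // exprn_gt0.
have nE : normc w = Num.sqrt m by rewrite /m -sqr_normcE sqrtr_sqr ger0_norm ?normc_ge0.
congr (_ +i* _).
  by rewrite nE -powR12_sqrt ?ltW // ln_powR.
rewrite /carg; set u := Im w / Re w.
have cosu : cos (atan u) = Re w / normc w.
  rewrite cos_atan nE; apply: (canLR invrK); rewrite invf_div.
  have -> : 1 + u ^+ 2 = m / Re w ^+ 2.
    by rewrite /u /m; field; rewrite gt_eqF.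
  rewrite sqrtrM ?ltW // sqrtrV ?sqr_ge0 // sqrtr_sqr gtr0_norm //.
rewrite -cosu; case: leP => h.
  rewrite cosK // in_itv /=; apply/andP; split.
    by rewrite -atan0; apply: le_atan; rewrite divr_ge0 // ltW.
  have := atan_ltpi2 u; have := @pi_gt0 R; lra.
rewrite cosKN ?opprK //; apply/andP; split.
  have := atan_gtNpi2 u; have := @pi_gt0 R; lra.
by rewrite -atan0; apply: le_atan; rewrite mulr_le0_ge0 ?invr_ge0 ?(ltW w0) ?(ltW h).
Qed.

Lemma is_cderive_log (f : R -> R[i]) t (d : R[i]) : 0 < Re (f t) ->
  is_cderive f t d -> is_cderive (fun u => log_atan (f u)) t (d / f t).
Proof.
move=> f0 [d1 d2].
set A := Re (f t) in f0; set B := Im (f t).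
have m0 : 0 < A ^+ 2 + B ^+ 2 by rewrite ltr_wpDr ?sqr_ge0 // exprn_gt0.
have fE : (f t)^-1 = (A / (A ^+ 2 + B ^+ 2)) +i* (- B / (A ^+ 2 + B ^+ 2)).
  have fn0 : f t != 0 by apply: contraTneq f0 => e; rewrite /A e ltxx.
  apply: (mulfI fn0); rewrite divff //; apply: complex_ext; rewrite ?ReM ?ImM /= -/A -/B.
    by field; rewrite gt_eqF.
  by field; rewrite gt_eqF.
have q : is_derive t 1 (fun u => Re (f u) ^+ 2 + Im (f u) ^+ 2) (2 * (A * Re d + B * Im d)).
  apply: is_derive_ext (is_deriveD (is_deriveM d1 d1) (is_deriveM d2 d2)).
    by move=> u /=; rewrite !expr2.
  by rewrite /GRing.scale /= -/A -/B; ring.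
split.
  have h := is_derive1_comp (g := fun u => Re (f u) ^+ 2 + Im (f u) ^+ 2) (is_derive1_ln m0) q.
  apply: is_derive_ext (is_deriveZ 2^-1 h) => //.
  rewrite ReM fE /= /GRing.scale /=; field; rewrite gt_eqF //.
have i : is_derive t 1 (fun u => (Re (f u))^-1) (- A ^- 2 * Re d).
  have := is_deriveV (f := fun u => Re (f u)) _ d1.
  rewrite -/A => /(_ (lt0r_neq0 f0)) h.
  by apply: is_derive_ext h => //; rewrite /GRing.scale /=; ring.
have h0 : is_derive t 1 (fun u => Im (f u) / Re (f u)) (Im d / A - B * Re d / A ^+ 2).
  apply: is_derive_ext (is_deriveM d2 i) => //.
  by rewrite /GRing.scale /= -/A -/B; ring.
have h := is_derive1_comp (g := fun u => Im (f u) / Re (f u)) (is_derive1_atan (B / A)) h0.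
apply: is_derive_ext h => //.
rewrite ImM fE /=; field.
rewrite !gt_eqF //=.
Qed.

(** The mean value theorem, applied to each component. *)
Lemma is_cderive0_const (f : R -> R[i]) t : 0 <= t ->
  (forall u, 0 <= u <= t -> is_cderive f u 0) -> f t = f 0.
Proof.
rewrite le_eqVlt => /predU1P[<-//|t0] df.
have key (g : R -> R) : (forall u, 0 <= u <= t -> is_derive u 1 g 0) -> g t = g 0.
  move=> dg.
  have [||c _] := @MVT R g (fun=> 0) 0 t t0.
  - by move=> u; rewrite in_itv /= => /andP[u0 u1]; apply: dg; rewrite !ltW.
  - apply: continuous_in_subspaceT => u; rewrite inE /= in_itv /= => /dg.
    exact: is_derive_continuous.
  by rewrite mul0r => /eqP; rewrite subr_eq0 => /eqP.
by apply: complex_ext; apply: (key (fun u => _)) => u /df[].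
Qed.

Lemma Re_ray_gt0 x t : normc x < 1 -> 0 <= t <= 1 -> 0 < Re (1 - x * t%:C).
Proof.
move=> x1 /andP[t0 t1]; rewrite ReB ReMr /= subr_gt0.
apply: le_lt_trans (ler_norm _) _; rewrite normrM (ger0_norm t0).
apply: le_lt_trans (_ : `|Re x| * 1 < 1); first by rewrite ler_wpM2l.
by rewrite mulr1; apply: le_lt_trans (Re_le_normc _) x1.
Qed.

(** The sum [f] of the series and [g t = (1 - x t) ^ a] satisfy
[f' = a x f / (1 - x t)] and [g' = - a x g / (1 - x t)], so [f g] is constant,
equal to its value 1 at [t = 0]. *)
Lemma binomial_theorem a x t : normc x < 1 -> 0 <= t <= 1 ->
  binomial_sum a (x * t%:C) = cpow (1 - x * t%:C) (- a).
Proof.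
move=> x1 t01; have /andP[t0 t1] := t01.
pose w u : R[i] := 1 - x * u%:C.
pose g u := cexp (a * log_atan (w u)).
have tn (u : R) : 0 <= u <= t -> 0 <= u <= 1 by move=> /andP[u0 ut]; rewrite u0 (le_trans ut).
have un (u : R) : 0 <= u <= 1 -> `|u| <= 1 by move=> /andP[u0 u1]; rewrite ger0_norm.
have dw (u : R) : is_cderive w u (- x).
  have h := is_cderiveD (is_cderive_cst u (1 : R[i])) (is_cderiveZ (- x) (is_cderive_id u)).
  rewrite mulr1 add0r in h.
  by rewrite /w; under eq_fun do rewrite -mulNr.
have dg (u : R) : 0 <= u <= 1 -> is_cderive g u (g u * (a * (- x / w u))).
  move=> u01; apply: is_cderive_cexp; apply: is_cderiveZ.
  by apply: is_cderive_log (dw u); exact: Re_ray_gt0.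
have dP (u : R) : 0 <= u <= t -> is_cderive (fun v => binomial_ray a x v * g v) u 0.
  move=> /tn u01.
  have h := is_cderiveM (is_cderive_binomial_ray a x1 (un _ u01)) (dg u u01).
  suff e : a * x * binomial_sum (a + 1) (x * u%:C) * g u +
    binomial_ray a x u * (g u * (a * (- x / w u))) = 0 by rewrite -e.
  have wn0 : w u != 0.
    by apply: contraTneq (Re_ray_gt0 x1 u01) => e; rewrite -/(w u) e ltxx.
  have xu1 : normc (x * u%:C) < 1.
    rewrite ComplexField.Normc.normcM normcR; apply: le_lt_trans x1.
    by rewrite ler_piMr ?normc_ge0 // un.
  rewrite (binomial_rayE a x1 (un _ u01)) -(binomial_sum_shift a xu1) -/(w u).
  by field.
have := is_cderive0_const t0 dP.
rewrite !(binomial_rayE a x1) ?un ?lexx ?ler01 //.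
have -> : g 0 = 1.
  rewrite /g /w mulr0 subr0 /log_atan /= expr1n expr0n addr0 ln1 mul0r atan0 mulr0.
  by rewrite -[_ +i* _]/(0 : R[i]) mulr0 cexp0.
have -> : binomial_sum a (x * (0 : R)%:C) = 1.
  rewrite mulr0 /binomial_sum; apply: (cseriesP _).2.
  apply: cvg_near_cst; exists 1%N => //= n n0.
  rewrite /series /= big_ltn // binomial_coef0 expr0 mulr1.
  rewrite big_nat_cond big1 ?addr0 // => k /andP[/andP[k0 _] _].
  by rewrite expr0n eqn0Ngt k0 mulr0.
rewrite mulr1 => P1.
have wt : 0 < Re (w t) by exact: Re_ray_gt0.
rewrite /cpow ifF; last by apply: contraTF wt => /eqP; rewrite /w => ->; rewrite ltxx.
rewrite clogE // mulNr cexpN.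
apply: (mulIf (cexp_neq0 (a * log_atan (w t)))).
by rewrite P1 mulVf // cexp_neq0.
Qed.

End principal_power.

(** * Unordered double sums *)

Section unordered_sums.
Import finmap summability.
Context {R : realType}.

Lemma sum_uniq_subset (V : zmodType) (T : eqType) (r1 r2 : seq T) (F : T -> V) :
  uniq r1 -> uniq r2 -> {subset r1 <= r2} ->
  \sum_(i <- r2) F i = \sum_(i <- r1) F i + \sum_(i <- r2 | i \notin r1) F i.
Proof.
move=> u1 u2 sub; rewrite (bigID (mem r1)) /=; congr (_ + _).
rewrite -big_filter; apply: perm_big; apply: uniq_perm => //.
  exact: filter_uniq.
move=> i; rewrite mem_filter /=; apply/andP/idP => [[]//|ir1].
by split => //; exact: sub.
Qed.

Definition square N : seq (nat * nat) := [seq (m, n) | m <- iota 0 N, n <- iota 0 N].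

Lemma square_uniq N : uniq (square N).
Proof. by apply: allpairs_uniq; rewrite ?iota_uniq // => -[? ?] [? ?] _ _ /= [-> ->]. Qed.

Lemma mem_square N m n : ((m, n) \in square N) = (m < N)%N && (n < N)%N.
Proof.
apply/allpairsP/andP => [[[a b] /= [ha hb [-> ->]]]|[hm hn]].
  by move: ha hb; rewrite !mem_iota.
by exists (m, n); rewrite /= !mem_iota.
Qed.

Lemma big_square (V : zmodType) N (F : nat * nat -> V) :
  \sum_(i <- square N) F i = \sum_(0 <= m < N) \sum_(0 <= n < N) F (m, n).
Proof. by rewrite big_allpairs /index_iota subn0. Qed.

(** A double series dominated by a product of two convergent series has as
unordered sum the limit of its square partial sums: the terms outside of a
large square have total mass at most [A * B - A_N * B_N]. *)
Lemma cseries2_square (u : nat -> nat -> R[i]) (L : R[i]) (a b : nat -> R) :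
  (forall n, 0 <= a n) -> (forall n, 0 <= b n) ->
  cvgn (series a) -> cvgn (series b) ->
  (forall m n, normc (u m n) <= a m * b n) ->
  ((fun N => \sum_(0 <= m < N) \sum_(0 <= n < N) u m n) : nat -> R[i]^o) @ \oo
    --> (L : R[i]^o) ->
  cseries2_cvg u /\ cseries2 u = L.
Proof.
move=> a0 b0 ca cb uab cuL.
have tF : ProperFilter (@totally (nat * nat)%type) by exact: totally_filter.
suff h : partial_sum (fun mn : nat * nat => u mn.1 mn.2 : R[i]^o) @ totally --> (L : R[i]^o).
  split; first by apply/cvg_ex; exists L.
  have limE := cvg_lim (@norm_hausdorff _ _) h.
  exact: limE.
set A := limn (series a) in ca; set B := limn (series b) in cb.
pose F (p : nat * nat) := u p.1 p.2; pose G (p : nat * nat) := a p.1 * b p.2.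
have G0 p : 0 <= G p by rewrite mulr_ge0.
have FG p : normc (F p) <= G p by exact: uab.
have sqG N : \sum_(i <- square N) G i = series a N * series b N.
  by rewrite big_square /series /= big_distrlr.
have AB N : series a N * series b N <= A * B.
  have nd (v : nat -> R) : (forall n, 0 <= v n) -> nondecreasing_seq (series v).
    by move=> v0; apply/nondecreasing_seqP => n; rewrite /series /= big_nat_recr //= lerDl.
  rewrite ler_pM ?sumr_ge0 //; exact: nondecreasing_cvgn_le (nd _ _) _ _.
have cAB : (fun N => series a N * series b N) @ \oo --> A * B by exact: cvgM.
apply/cvgrPdist_lt => e e0.
have [e1 e2] : Im e = 0 /\ 0 < Re e by move: e0; rewrite ltcE => /andP[/eqP].
have eE : e = (Re e)%:C by apply: complex_ext.
have e3 : 0 < Re e / 2 by rewrite divr_gt0.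
have e3C : 0 < (Re e / 2)%:C :> R[i] by rewrite ltcR.
move/cvgrPdist_lt : cAB => /(_ _ e3) h1.
move/cvgrPdist_lt : cuL => /(_ _ e3C) h2.
have [N _ hN] : \forall N \near \oo, `|A * B - series a N * series b N| < Re e / 2 /\
    `|L - \sum_(0 <= m < N) \sum_(0 <= n < N) u m n| < (Re e / 2)%:C.
  by near=> N; split; near: N; [exact: h1|exact: h2].
have [{}h1 {}h2] := hN N (leqnn N).
exists (seq_fset tt (square N)) => //= J subJ.
pose s : seq (nat * nat) := enum_fset J.
have sub : {subset square N <= s}.
  move=> p pN; have pS : p \in seq_fset tt (square N) by rewrite seq_fsetE.
  exact: (fsubsetP subJ).
have -> : partial_sum (fun mn : nat * nat => u mn.1 mn.2 : R[i]^o) J =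
    \sum_(i <- s) F i.
  by rewrite /partial_sum big_seq_fsetE.
have uJ : uniq s by exact: fset_uniq.
rewrite (sum_uniq_subset F (square_uniq N) uJ sub) opprD addrA.
rewrite normc_normr eE ltcR (splitr (Re e)).
apply: le_lt_trans (normcD _ _) _; apply: ltr_leD.
  by rewrite big_square -ltcR -normc_normr.
rewrite normcN; apply: le_trans (normc_sum _ _ _) _.
apply: (@le_trans _ _ (\sum_(i <- s | i \notin square N) G i)).
  by apply: ler_sum => p _; exact: FG.
have E1 := sum_uniq_subset G (square_uniq N) uJ sub.
(* [J] lies in a larger square, so its total mass is at most [A * B]. *)
have [M JM] : exists M, {subset s <= square M}.
  exists (\sum_(p <- s) (p.1 + p.2).+1)%N => -[m n] pJ.
  rewrite mem_square (perm_big _ (perm_to_rem pJ)) /= big_cons /=.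
  by apply/andP; split; rewrite addSn ltnS -addnA ?leq_addr // addnCA leq_addr.
have E2 := sum_uniq_subset G uJ (square_uniq M) JM.
have p2 : 0 <= \sum_(i <- square M | i \notin s) G i by apply: sumr_ge0.
have := AB M; rewrite -sqG => h3.
have h4 := ler_norm (A * B - series a N * series b N).
rewrite -sqG in h1 h4; lra.
Unshelve. all: by end_near. Qed.

End unordered_sums.

(** * The Mittag-Leffler majorant and beta kernels *)

Section mittag_leffler_beta.
Context {R : realType}.
Implicit Types (z w : R[i]) (t r : R).

(** For [lambda > 0], [real_gamma_ge] with [M ^ lambda = 2 (r + 1)] bounds the terms
by [exp M (r / (2 (r + 1))) ^ k]. *)
Lemma mittag_leffler_geometric (lambda : R) (r : R) : 0 <= lambda -> 0 <= r ->
  (lambda = 0 -> r < 1) ->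
  exists C q, [/\ 0 <= C, 0 < q < 1 &
    forall k, r ^+ k / real_gamma (lambda * k%:R + 1) <= C * q ^+ k].
Proof.
move=> l0 r0 rl.
have [l00|ln0] := eqVneq lambda 0.
  have r1 := rl l00.
  exists 1, ((r + 1) / 2); split => //; first by apply/andP; split; lra.
  move=> k; rewrite l00 mul0r add0r real_gamma1 divr1 mul1r.
  by rewrite lerXn2r // ?nnegrE //; lra.
have lp : 0 < lambda by rewrite lt0r ln0.
pose M := expR (ln (2 * (r + 1)) / lambda).
have M0 : 0 < M by exact: expR_gt0.
exists (expR M), (2^-1); split; first exact: expR_ge0.
  by rewrite invr_gt0 ltr0n invf_lt1 // ltr1n.
move=> k.
have s1 : 1 <= lambda * k%:R + 1 by rewrite lerDr mulr_ge0.
have := real_gamma_ge s1 M0.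
rewrite addrK /M expRK -/M.
have -> : lambda * k%:R * (ln (2 * (r + 1)) / lambda) = k%:R * ln (2 * (r + 1)).
  by field; rewrite gt_eqF.
rewrite expRM_natl lnK ?posrE; last lra.
move=> h; rewrite ler_pdivrMr ?real_gamma_gt0 //.
have eM : expR M * expR (- M) = 1 by rewrite -expRD subrr expR0.
have h2 : expR M * 2^-1 ^+ k * ((2 * (r + 1)) ^+ k * expR (- M)) <=
   expR M * 2^-1 ^+ k * real_gamma (lambda * k%:R + 1).
  by rewrite ler_wpM2l // mulr_ge0 ?expR_ge0 ?exprn_ge0.
apply: le_trans h2.
have -> : expR M * 2^-1 ^+ k * ((2 * (r + 1)) ^+ k * expR (- M)) =
    (expR M * expR (- M)) * (2^-1 * (2 * (r + 1))) ^+ k by rewrite [in RHS]exprMn; ring.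
rewrite eM mul1r mulrA mulVf // mul1r lerXn2r // ?nnegrE //; lra.
Qed.

Lemma mulr_onem_le_quarter t : t * (1 - t) <= 4^-1.
Proof. by have := sqr_ge0 (t - 2^-1); rewrite expr2; lra. Qed.

Lemma mittag_leffler_term_bound (lambda : R) (p : R[i]) t k :
  0 <= lambda -> 0 < t < 1 ->
  normc (mittag_leffler_term lambda (p * t%:C * (1 - t%:C)) k) <=
  (normc p / 4) ^+ k / real_gamma (lambda * k%:R + 1).
Proof.
move=> l0 /andP[t0 t1].
have s1 : 1 <= lambda * k%:R + 1 by rewrite lerDr mulr_ge0.
rewrite /mittag_leffler_term gamma_real ?(lt_le_trans ltr01) //.
rewrite ComplexField.Normc.normcM ComplexField.Normc.normcV normcR normcX.
rewrite (gtr0_norm (real_gamma_gt0 s1)).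
rewrite ler_wpM2r ?invr_ge0 ?(ltW (real_gamma_gt0 s1)) //.
rewrite lerXn2r ?nnegrE ?normc_ge0 ?divr_ge0 ?normc_ge0 //.
rewrite -mulrA -[1 : R[i]]/(1%:C) -rmorphB -rmorphM ComplexField.Normc.normcM normcR.
rewrite ler_wpM2l ?normc_ge0 // ger0_norm ?mulr_ge0 ?subr_ge0 ?(ltW t0) ?(ltW t1) //.
exact: mulr_onem_le_quarter.
Qed.

Lemma beta_kernelDn z w m n t :
  beta_kernel (z + m%:R) (w + n%:R) t =
  beta_kernel z w t * (t%:C ^+ m * (1 - t%:C) ^+ n).
Proof.
have pk (v : R[i]) (k : nat) (s : R) :
    power_kernel (v + k%:R) s = power_kernel v s * s%:C ^+ k.
  rewrite /power_kernel; case: ifP => s0; last by rewrite mul0r.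
  have -> : s%:C ^+ k = cexp (k%:R * (ln s)%:C) :> R[i].
    by rewrite natC -!rmorphM cexp_real expRM_natl lnK // rmorphXn.
  by rewrite -cexpD; congr cexp; ring.
rewrite /beta_kernel !pk rmorphB; ring.
Qed.

Lemma beta_kernelE (z w : R[i]) t : 0 < t < 1 ->
  beta_kernel z w t = cpow t%:C (z - 1) * cpow (1 - t%:C) (w - 1).
Proof.
move=> /andP[t0 t1]; have t2 : 0 < 1 - t by rewrite subr_gt0.
rewrite /beta_kernel /power_kernel t0 t2 cpow_gt0 //.
by rewrite -[1 - t%:C]/(1%:C - t%:C) -rmorphB cpow_gt0.
Qed.

Lemma beta_kernel_unit (z w : R[i]) :
  beta_kernel z w = fun t => if t \in `]0, 1[%classic then beta_kernel z w t else 0.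
Proof.
apply/funext => t; rewrite mem_setE in_itv /=.
rewrite /beta_kernel /power_kernel subr_gt0.
by case: (0 < t); case: (t < 1); rewrite ?mulr0 ?mul0r.
Qed.

Lemma beta_integralE (z w : R[i]) :
  beta_integral z w = cintegral `]0, 1[ (beta_kernel z w).
Proof. by rewrite cintegral_mkcond -beta_kernel_unit. Qed.

Lemma cintegrable_beta_kernel_unit (z w : R[i]) : 0 < Re z -> 0 < Re w ->
  cintegrable `]0, 1[ (beta_kernel z w).
Proof.
move=> z0 w0; apply/cintegrable_mkcond => //.
by rewrite -beta_kernel_unit; exact: cintegrable_beta_kernel.
Qed.

Lemma beta_integral_gamma z w : 0 < Re z -> 0 < Re w ->
  beta_integral z w = gamma z * gamma w / gamma (z + w).
Proof.
move=> z0 w0; rewrite gamma_beta // mulfK //.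
by apply: gamma_neq0; rewrite ReD addr_gt0.
Qed.

End mittag_leffler_beta.

(** * Integrating the Mittag-Leffler series *)

Section assembly.
Context {R : realType}.
Implicit Types (z w : R[i]) (t r : R).

Lemma ccvg_normc_le (u : nat -> R[i]) (l : R[i]) (M : R) :
  ((u : nat -> R[i]^o) @ \oo --> (l : R[i]^o)) ->
  (forall n, normc (u n) <= M) -> normc l <= M.
Proof.
move=> /cvgrPdist_lt ul uM; rewrite leNgt; apply/negP => Ml.
have e0 : 0 < (normc l - M)%:C :> R[i] by rewrite ltcR subr_gt0.
have [N _ /(_ N (leqnn N))] := ul _ e0.
rewrite normc_normr ltcR => h.
have := normcD (l - u N) (u N); rewrite subrK => h2.
have := uM N; lra.
Qed.

Lemma series_geometric_le (u : nat -> R[i]) (C q : R) N : 0 <= C -> 0 < q < 1 ->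
  (forall n, normc (u n) <= C * q ^+ n) ->
  normc (series u N) <= C * (1 - q)^-1.
Proof.
move=> C0 /andP[q0 q1] uC.
apply: le_trans (@geometric_le_lim R N C q C0 q0 _); last by rewrite gtr0_norm.
apply: le_trans (normc_sum _ _ _) _.
by rewrite /series /= ler_sum.
Qed.

Definition mittag_leffler_along (lambda : R) (p : R[i]) t : R[i] :=
  mittag_leffler lambda (p * t%:C * (1 - t%:C)).

Lemma mittag_leffler_along_bounded (lambda : R) (p : R[i]) : 0 <= lambda ->
  (lambda = 0 -> normc p < 4) ->
  (forall t, 0 < t < 1 -> cseries_cvg (mittag_leffler_term lambda (p * t%:C * (1 - t%:C)))) /\
  exists M, 0 <= M /\ forall t, 0 < t < 1 ->
    (forall N, normc (series (mittag_leffler_term lambda (p * t%:C * (1 - t%:C))) N) <= M) /\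
    normc (mittag_leffler_along lambda p t) <= M.
Proof.
move=> l0 pl.
have [||C [q [C0 q01 h]]] := @mittag_leffler_geometric R lambda (normc p / 4) l0.
- by rewrite divr_ge0 // normc_ge0.
- by move=> /pl p4; rewrite ltr_pdivrMr // mul1r.
have b t k : 0 < t < 1 ->
    normc (mittag_leffler_term lambda (p * t%:C * (1 - t%:C)) k) <= C * q ^+ k.
  by move=> t01; apply: le_trans (h k); exact: mittag_leffler_term_bound.
have cv t : 0 < t < 1 -> cseries_cvg (mittag_leffler_term lambda (p * t%:C * (1 - t%:C))).
  by move=> t01; apply: cseries_geometric q01 _ => k; exact: b.
split => //; exists (C * (1 - q)^-1); split.
  by rewrite mulr_ge0 // invr_ge0 subr_ge0 ltW //; case/andP : q01.
move=> t t01; split.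
  by move=> N; apply: series_geometric_le => // k; exact: b.
apply: ccvg_normc_le (cv _ t01) _ => N.
by apply: series_geometric_le => // k; exact: b.
Qed.

(** Each monomial [(t (1 - t)) ^ k] shifts both parameters of the beta kernel
by [k]; the partial sums of the Mittag-Leffler series are bounded on ]0, 1[. *)
Lemma beta_mittag_leffler z w (lambda : R) (p : R[i]) :
  0 < Re z -> 0 < Re w -> 0 <= lambda -> (lambda = 0 -> normc p < 4) ->
  cintegrable `]0, 1[ (fun t => beta_kernel z w t * mittag_leffler_along lambda p t) /\
  (series (fun k => p ^+ k / gamma (lambda * k%:R + 1)%:C *
      beta_integral (z + k%:R) (w + k%:R)) : nat -> R[i]^o) @ \oo -->
  (cintegral `]0, 1[ (fun t => beta_kernel z w t * mittag_leffler_along lambda p t) : R[i]^o).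
Proof.
move=> z0 w0 l0 pl.
have [cv [M [M0 bM]]] := mittag_leffler_along_bounded l0 pl.
pose term t := mittag_leffler_term lambda (p * t%:C * (1 - t%:C)).
pose f_ N t := \sum_(0 <= k < N) (p ^+ k / gamma (lambda * k%:R + 1)%:C *
   beta_kernel (z + k%:R) (w + k%:R) t).
have f_E N t : f_ N t = beta_kernel z w t * series (term t) N.
  rewrite /f_ /series /= mulr_sumr; apply: eq_bigr => k _.
  by rewrite beta_kernelDn /term /mittag_leffler_term !exprMn; ring.
have mD : measurable (`]0, 1[%classic : set (measurableTypeR R)) by exact: measurable_itv.
have iB k : cintegrable `]0, 1[ (fun t => p ^+ k / gamma (lambda * k%:R + 1)%:C *
   beta_kernel (z + k%:R) (w + k%:R) t) /\
   cintegral `]0, 1[ (fun t => p ^+ k / gamma (lambda * k%:R + 1)%:C *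
   beta_kernel (z + k%:R) (w + k%:R) t) =
   p ^+ k / gamma (lambda * k%:R + 1)%:C * beta_integral (z + k%:R) (w + k%:R).
  rewrite beta_integralE; apply: cintegralZ => //.
  by apply: cintegrable_beta_kernel_unit; rewrite ReDn ltr_wpDr.
have is_ N := cintegral_sum (index_iota 0 N) mD (fun k => (iB k).1).
have [||||H1 H2] := @cintegral_cvg R `]0, 1[ f_
  (fun t => beta_kernel z w t * mittag_leffler_along lambda p t)
  (fun t => normc (beta_kernel z w t) * M) mD.
- by move=> N; exact: cintegrable_measurable (is_ N).1.
- move=> t; rewrite /= in_itv /= => t01; under eq_fun do rewrite f_E.
  by apply: ccvgM; [exact: cvg_cst|exact: cv].
- move=> N t; rewrite /= in_itv /= => t01; rewrite f_E ComplexField.Normc.normcM.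
  by rewrite ler_wpM2l ?normc_ge0 //; exact: (bM _ t01).1.
- have := cintegrable_normc mD (cintegrable_beta_kernel_unit z0 w0).
  move=> /(integrableZr mD M); apply: eq_integrable => // t _ /=.
split => //; rewrite [X in X @ _](_ : _ = (fun N => cintegral `]0, 1[ (f_ N))) //.
apply/funext => N; rewrite (is_ N).2 /series /=.
by apply: eq_bigr => k _; rewrite (iB k).2.
Qed.

(** The factor [(1)_k] cancels [k!], and [Gamma 1 = 1]; what remains is a quotient
of gammas that [beta_integral_gamma] recognizes. *)
Lemma wright_hat_termE z w (lambda : R) (p : R[i]) k :
  0 < Re z -> 0 < Re w -> 0 <= lambda ->
  wright_hat_term [:: (z, 1); (w, 1); (1, 1)] [:: (z + w, 2); (1, lambda)] p k =
  (beta_function z w)^-1 * (p ^+ k / gamma (lambda * k%:R + 1)%:C *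
    beta_integral (z + k%:R) (w + k%:R)).
Proof.
move=> z0 w0 l0; rewrite /wright_hat_term !big_cons !big_nil /wright_factor /=.
rewrite (mul1r (k%:R : R)) -natC [_ * 1 in X in X / _]mulr1 [_ * 1 in X in _ / X]mulr1.
have -> : (2 * k%:R)%:C = k%:R + k%:R :> R[i].
  by rewrite natC -rmorphD; congr (_%:C); ring.
have -> : 1 + (lambda * k%:R)%:C = (lambda * k%:R + 1)%:C :> R[i].
  by rewrite addrC -[1 : R[i]]/(1%:C) -rmorphD.
have -> : gamma (1 + k%:R) = k`!%:R :> R[i].
  by rewrite gammaDn ?ltr01 // gamma1 mulr1 pochhammer1.
rewrite gamma1 beta_integral_gamma; try by rewrite ReDn ltr_wpDr.
have -> : z + k%:R + (w + k%:R) = z + w + (k%:R + k%:R) by ring.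
have zw0 : 0 < Re (z + w) by rewrite ReD addr_gt0.
have g1 := gamma_neq0 z0; have g2 := gamma_neq0 w0; have g3 := gamma_neq0 zw0.
have g4 : gamma (z + w + (k%:R + k%:R)) != 0.
  by apply: gamma_neq0; rewrite -natrD ReDn ltr_wpDr.
have g5 : gamma (lambda * k%:R + 1)%:C != 0 :> R[i].
  by apply: gamma_neq0; rewrite /= ltr_wpDl ?mulr_ge0.
have kn0 := @fact_neq0C R k.
rewrite /beta_function.
move: kn0 g1 g2 g3 g4 g5.
move: (k`!%:R : R[i]) (gamma z) (gamma w) (gamma (z + w)) (gamma (z + w + (k%:R + k%:R)))
  (gamma (lambda * k%:R + 1)%:C) (gamma (z + k%:R)) (gamma (w + k%:R)) (p ^+ k).
move=> f gz gw gzw g' gl gzk gwk pk f0 gz0 gw0 gzw0 g'0 gl0.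
by field; rewrite f0 gz0 gw0 gzw0 g'0 gl0.
Qed.

Lemma beta_function_shift z w m n : 0 < Re z -> 0 < Re w ->
  (beta_function (z + m%:R) (w + n%:R))^-1 =
  pochhammer (z + w) (m + n) / (pochhammer z m * pochhammer w n) *
    (beta_function z w)^-1.
Proof.
move=> z0 w0; rewrite /beta_function.
have -> : z + m%:R + (w + n%:R) = z + w + (m + n)%:R by rewrite natrD; ring.
have zw0 : 0 < Re (z + w) by rewrite ReD addr_gt0.
rewrite !gammaDn //.
have g1 := gamma_neq0 z0; have g2 := gamma_neq0 w0; have g3 := gamma_neq0 zw0.
have q1 := pochhammer_neq0 m z0; have q2 := pochhammer_neq0 n w0.
have q3 := pochhammer_neq0 (m + n) zw0.
by field; rewrite g1 g2 g3 q1 q2 q3.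
Qed.

End assembly.

(** * The double series *)

Section double_series.
Context {R : realType}.
Implicit Types (t r : R).

(** [A] majorizes the coefficients in the double series, [M] the partial sums under
the integral. *)
Lemma binomial_series_bound (a x : R[i]) : normc x < 1 ->
  exists M (A : nat -> R), [/\ 0 <= M, forall n, 0 <= A n, cvgn (series A),
    forall n, normc (binomial_coef a n * x ^+ n) <= A n &
    forall t N, 0 <= t <= 1 ->
      normc (series (fun n => binomial_coef a n * (x * t%:C) ^+ n) N) <= M].
Proof.
move=> x1.
have [|C [q [C0 q01 h]]] := @binomial_coef_geometric R a (normc x).
  by rewrite normc_ge0.
have /andP[q0 q1] := q01.
have h2 n : normc (binomial_coef a n * x ^+ n) <= C * q ^+ n.
  by rewrite ComplexField.Normc.normcM normcX.
exists (C * (1 - q)^-1), (geometric C q); split => //.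
- by rewrite mulr_ge0 // invr_ge0 subr_ge0 ltW.
- by move=> n; apply: geometric_ge0 => //; exact: ltW.
- by apply: is_cvg_geometric_series; rewrite gtr0_norm.
- move=> t N /andP[t0 t1]; apply: series_geometric_le => // n.
  apply: le_trans (h2 n); rewrite exprMn mulrA ComplexField.Normc.normcM.
  rewrite [X in _ * X]normcX normcR ger0_norm //.
  by rewrite ler_piMr ?normc_ge0 // exprn_ile1.
Qed.

(** A bound that does not depend on [m] and [n], since [t ^ m (1 - t) ^ n <= 1]. *)
Lemma cintegral_beta_le z w (E : R -> R[i]) (M : R) (m n : nat) :
  0 < Re z -> 0 < Re w -> 0 <= M ->
  (forall t, 0 < t < 1 -> normc (E t) <= M) ->
  cintegrable `]0, 1[ (fun t => beta_kernel (z + m%:R) (w + n%:R) t * E t) ->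
  normc (cintegral `]0, 1[ (fun t => beta_kernel (z + m%:R) (w + n%:R) t * E t)) <=
  2 * \int[mu]_(t in `]0, 1[) (normc (beta_kernel z w t) * M).
Proof.
move=> z0 w0 M0 EM iE.
have mD : measurable (`]0, 1[%classic : set (measurableTypeR R)) by exact: measurable_itv.
apply: cintegral_le => //.
  move=> t; rewrite /= in_itv /= => t01.
  have /andP[t0 t1] := t01.
  rewrite ComplexField.Normc.normcM beta_kernelDn.
  apply: ler_pM; rewrite ?normc_ge0 //; last exact: EM.
  rewrite ComplexField.Normc.normcM ler_piMr ?normc_ge0 //.
  rewrite -[1 - t%:C]/(1%:C - t%:C) -rmorphB -!rmorphXn -rmorphM normcR.
  rewrite ger0_norm ?mulr_ge0 ?exprn_ge0 ?subr_ge0 ?(ltW t0) ?(ltW t1) //.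
  by rewrite mulr_ile1 ?exprn_ge0 ?exprn_ile1 ?subr_ge0 ?(ltW t0) ?(ltW t1) //; lra.
have := cintegrable_normc mD (cintegrable_beta_kernel_unit z0 w0).
by move=> /(integrableZr mD M); apply: eq_integrable => // t _ /=.
Qed.

End double_series.

Theorem theorem2 (R : realType) (alpha beta alpha1 alpha2 x1 x2 p : R[i])
    (lambda : R)
    (alpha_gt0 : 0 < complex.Re alpha) (beta_gt0 : 0 < complex.Re beta)
    (lambda_ge0 : 0 <= lambda) (x1_lt1 : `|x1| < 1) (x2_lt1 : `|x2| < 1)
    (p_lt4 : lambda = 0 -> `|p| < 4) :
  let integrand (t : R) : R[i] :=
    cpow t%:C (alpha - 1) * cpow (1 - t%:C) (beta - 1) *
    cpow (1 - x1 * t%:C) (- alpha1) * cpow (1 - x2 * (1 - t%:C)) (- alpha2) *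
    mittag_leffler lambda (p * t%:C * (1 - t%:C)) in
  let upper (m n : nat) : seq (R[i] * R) :=
    [:: (alpha + m%:R, 1); (beta + n%:R, 1); (1, 1)] in
  let lower (m n : nat) : seq (R[i] * R) :=
    [:: (alpha + beta + (m + n)%:R, 2); (1, lambda)] in
  let summand (m n : nat) : R[i] :=
    pochhammer alpha m * pochhammer beta n *
    pochhammer alpha1 m * pochhammer alpha2 n * x1 ^+ m * x2 ^+ n /
    (pochhammer (alpha + beta) (m + n) * m`!%:R * n`!%:R) *
    wright_hat (upper m n) (lower m n) p in
  [/\ forall t : R, 0 < t < 1 ->
        cseries_cvg (mittag_leffler_term lambda (p * t%:C * (1 - t%:C))),
      cintegrable `]0, 1[ integrand,
      forall m n : nat, cseries_cvg (wright_hat_term (upper m n) (lower m n) p),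
      cseries2_cvg summand
    & (beta_function alpha beta)^-1 * cintegral `]0, 1[ integrand = cseries2 summand].
Proof.
move=> integrand upper lower summand.
have x1n : normc x1 < 1 by rewrite -ltcR -normc_normr.
have x2n : normc x2 < 1 by rewrite -ltcR -normc_normr.
have pn : lambda = 0 -> normc p < 4.
  by move=> /p_lt4; rewrite normc_normr -[4 : R[i]](rmorph_nat (real_complex R)) ltcR.
have [cvE [M [M0 bM]]] := mittag_leffler_along_bounded lambda_ge0 pn.
pose E := mittag_leffler_along lambda p.
have mD : measurable (`]0, 1[%classic : set (measurableTypeR R)) by exact: measurable_itv.
have [M1 [A [M10 A0 cA bA bM1]]] := binomial_series_bound alpha1 x1n.
have [M2 [B [M20 B0 cB bB bM2]]] := binomial_series_bound alpha2 x2n.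
pose G m n t := beta_kernel (alpha + m%:R) (beta + n%:R) t * E t.
have am0 m : 0 < Re (alpha + m%:R) by rewrite ReDn ltr_wpDr.
have bn0 n : 0 < Re (beta + n%:R) by rewrite ReDn ltr_wpDr.
have iG m n := beta_mittag_leffler (am0 m) (bn0 n) lambda_ge0 pn.
pose c := (beta_function alpha beta)^-1.
pose I m n := cintegral `]0, 1[ (G m n).
have lowerE m n : lower m n =
    [:: (alpha + m%:R + (beta + n%:R), 2); (1, lambda)].
  by rewrite /lower; congr [:: (_, _); _]; rewrite natrD; ring.
have wright m n : cseries_cvg (wright_hat_term (upper m n) (lower m n) p) /\
    wright_hat (upper m n) (lower m n) p =
    (beta_function (alpha + m%:R) (beta + n%:R))^-1 * I m n.
  have [cI sI] := cseriesP (iG m n).2.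
  rewrite /wright_hat lowerE /upper.
  have -> : wright_hat_term [:: (alpha + m%:R, 1); (beta + n%:R, 1); (1, 1)]
      [:: (alpha + m%:R + (beta + n%:R), 2); (1, lambda)] p =
    fun k => (beta_function (alpha + m%:R) (beta + n%:R))^-1 *
      (p ^+ k / gamma (lambda * k%:R + 1)%:C *
       beta_integral (alpha + m%:R + k%:R) (beta + n%:R + k%:R)).
    by apply/funext => k; exact: wright_hat_termE.
  by rewrite /I -sI; exact: cseriesZ.
pose u m n := (binomial_coef alpha1 m * x1 ^+ m) * (binomial_coef alpha2 n * x2 ^+ n).
have summandE m n : summand m n = c * (u m n * I m n).
  rewrite /summand (wright m n).2 beta_function_shift // -/c.
  have q1 := pochhammer_neq0 m alpha_gt0; have q2 := pochhammer_neq0 n beta_gt0.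
  have q3 : pochhammer (alpha + beta) (m + n) != 0.
    by apply: pochhammer_neq0; rewrite ReD addr_gt0.
  have f1 := @fact_neq0C R m; have f2 := @fact_neq0C R n.
  rewrite /u /binomial_coef; move: q1 q2 q3 f1 f2.
  move: (pochhammer alpha m) (pochhammer beta n) (pochhammer (alpha + beta) (m + n))
    (m`!%:R : R[i]) (n`!%:R : R[i]) (pochhammer alpha1 m) (pochhammer alpha2 n)
    (x1 ^+ m) (x2 ^+ n) (I m n) c => *.
  by field; repeat (apply/andP; split).
pose K := 2 * \int[mu]_(t in `]0, 1[) (normc (beta_kernel alpha beta t) * M).
have IK m n : normc (I m n) <= K.
  by apply: cintegral_beta_le (iG m n).1 => // t t01; exact: (bM t t01).2.
pose S1 N t := series (fun m => binomial_coef alpha1 m * (x1 * t%:C) ^+ m) N.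
pose S2 N t := series (fun n => binomial_coef alpha2 n * (x2 * (1 - t)%:C) ^+ n) N.
(* The integrand is the pointwise limit of the square partial sums [f_ N], each
   of which factors into one-variable partial sums. *)
pose f_ N t := \sum_(0 <= m < N) \sum_(0 <= n < N) (u m n * G m n t).
have f_E N t : f_ N t = beta_kernel alpha beta t * E t * (S1 N t * S2 N t).
  rewrite /S1 /S2 /series /= big_distrlr /= mulr_sumr; apply: eq_bigr => m _.
  rewrite mulr_sumr; apply: eq_bigr => n _.
  rewrite /u /G beta_kernelDn !exprMn rmorphB; ring.
have isum m n := cintegralZ (u m n) mD (iG m n).1.
have isum2 N m := cintegral_sum (index_iota 0 N) mD (fun n => (isum m n).1).
have isum3 N := cintegral_sum (index_iota 0 N) mD (fun m => (isum2 N m).1).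
have limE t : 0 < t < 1 ->
    (f_ ^~ t : nat -> R[i]^o) @ \oo --> (integrand t : R[i]^o).
  move=> t01; have /andP[t0 t1] := t01.
  under eq_fun do rewrite f_E.
  have t01' : 0 <= t <= 1 by rewrite (ltW t0) (ltW t1).
  have s01 : 0 <= 1 - t <= 1 by rewrite subr_ge0 gerBl (ltW t0) (ltW t1).
  have ray (x : R[i]) (s : R) : normc x < 1 -> 0 <= s <= 1 -> normc (x * s%:C) < 1.
    move=> xn /andP[s0 s1]; rewrite ComplexField.Normc.normcM normcR ger0_norm //.
    by apply: le_lt_trans xn; rewrite ler_piMr ?normc_ge0.
  have -> : integrand t = beta_kernel alpha beta t * E t *
      (binomial_sum alpha1 (x1 * t%:C) * binomial_sum alpha2 (x2 * (1 - t)%:C)).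
    rewrite !binomial_theorem // beta_kernelE // /integrand rmorphB.
    by rewrite -/(mittag_leffler_along lambda p t) -/(E t); ring.
  apply: ccvgM; first exact: cvg_cst.
  apply: ccvgM.
    by apply: cvg_binomial_series; exact: ray.
  by apply: cvg_binomial_series; exact: ray.
have [||||H1 H2] := @cintegral_cvg R `]0, 1[ f_ integrand
  (fun t => normc (beta_kernel alpha beta t) * (M * (M1 * M2))) mD.
- by move=> N; exact: cintegrable_measurable (isum3 N).1.
- by move=> t; rewrite /= in_itv /=; exact: limE.
- move=> N t; rewrite /= in_itv /= => t01; have /andP[t0 t1] := t01.
  rewrite f_E -mulrA ComplexField.Normc.normcM ler_wpM2l ?normc_ge0 //.
  rewrite ComplexField.Normc.normcM ler_pM ?normc_ge0 //.
    exact: (bM t t01).2.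
  rewrite ComplexField.Normc.normcM ler_pM ?normc_ge0 //.
    by apply: bM1; rewrite (ltW t0) (ltW t1).
  by apply: bM2; rewrite subr_ge0 gerBl (ltW t0) (ltW t1).
- have := cintegrable_normc mD (cintegrable_beta_kernel_unit alpha_gt0 beta_gt0).
  by move=> /(integrableZr mD (M * (M1 * M2))); apply: eq_integrable => // t _ /=.
have K0 : 0 <= K by apply: le_trans (IK 0%N 0%N); exact: normc_ge0.
have cK0 : 0 <= normc c * K by rewrite mulr_ge0 ?normc_ge0.
have [||||H3 H4] := @cseries2_square R summand (c * cintegral `]0, 1[ integrand)
  A (fun n => normc c * K * B n) A0 _ cA.
- by move=> n; rewrite mulr_ge0.
- exact: (is_cvg_seriesZ (k := normc c * K) cB).
- move=> m n; rewrite summandE (ComplexField.Normc.normcM c) mulrC.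
  have -> : A m * (normc c * K * B n) = (A m * B n * K) * normc c by ring.
  rewrite ler_wpM2r ?normc_ge0 // (ComplexField.Normc.normcM (u m n)).
  rewrite ler_pM ?normc_ge0 // /u ComplexField.Normc.normcM.
  by rewrite ler_pM ?normc_ge0.
- rewrite [X in X @ _](_ : _ = (fun N => c * cintegral `]0, 1[ (f_ N))).
    by apply: ccvgM; [exact: cvg_cst|exact: H2].
  apply/funext => N; rewrite (isum3 N).2 mulr_sumr; apply: eq_bigr => m _.
  rewrite (isum2 N m).2 mulr_sumr; apply: eq_bigr => n _.
  by rewrite (isum m n).2 summandE.
split.
- exact: cvE.
- exact: H1.
- by move=> m n; exact: (wright m n).1.
- exact: H3.
- by rewrite H4.
Qed.
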